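(* Let $(a_1,a_2)\in\mathbb{R}^2$ satisfy $a_1+a_2=1$ and $a_2\in(-1,1]$ (i.e. $(a_1,a_2)\in P\setminus\{(2,-1)\}$), and let $X$ be the AR(2)-process with coefficients $a_1,a_2$. Assume that $\mathbb{E}[Y_1]=0$ and $\mathbb{E}[e^{|Y_1|^\alpha}]<\infty$ for some $\alpha>0$. Then $$p_N = N^{-1/2+o(1)}\ \ (N\to\infty)\quad\text{if } |a_2|<1,\qquad p_N\asymp N^{-1}\quad\text{if } a_2=1 .$$
   Context: Let $(Y_n)_{n\ge1}$ be i.i.d. nondegenerate real random variables. For fixed $p\ge1$ and real coefficients $a_1,\dots,a_p$, the AR($p$)-process $X$ is defined by $X_n=\sum_{k=1}^p a_kX_{n-k}+Y_n$ for $n\ge1$, with the convention $X_n=0$ for $n\le0$. The survival probability is $p_N(x):=\mathbb{P}(\sup_{n=1,\dots,N}X_n\le x)$ for $N\ge1$, $x\ge0$, and $p_N:=p_N(0)$. $P:=\{(a_1,a_2): a_1+a_2=1,\ a_2\in[-1,1]\}$. For positive functions, $f\precsim g$ means $\limsup f/g<\infty$, and $f\asymp g$ means $f\precsim g$ and $g\precsim f$. *)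

(* Defs.v *)
From HB Require Import structures.
From mathcomp Require Import all_boot all_order all_algebra.
From mathcomp Require Import all_classical all_reals all_analysis.

Set Implicit Arguments.
Unset Strict Implicit.
Unset Printing Implicit Defensive.

Import Order.TTheory GRing.Theory Num.Theory.
Local Open Scope classical_set_scope.
Local Open Scope ring_scope.

Definition mutually_independent d (T : measurableType d) (R : realType)
  (P : probability T R) (Y : nat -> {RV P >-> R}) : Prop :=
  forall (s : seq nat) (B : nat -> set R),
    uniq s -> (forall i, measurable (B i)) ->
    P (\bigcap_(i in [set` s]) (Y i @^-1` B i)) =
    (\prod_(i <- s) P (Y i @^-1` B i))%E.

Definition identically_distributed d (T : measurableType d) (R : realType)
  (P : probability T R) (Y : nat -> {RV P >-> R}) : Prop :=
  forall (n : nat) (B : set R), measurable B ->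
    P (Y n @^-1` B) = P (Y 0%N @^-1` B).

Definition iid_seq d (T : measurableType d) (R : realType)
  (P : probability T R) (Y : nat -> {RV P >-> R}) : Prop :=
  mutually_independent Y /\ identically_distributed Y.

Definition nondegenerate_rv d (T : measurableType d) (R : realType)
  (P : probability T R) (X : {RV P >-> R}) : Prop :=
  forall c : R, P [set w | X w = c] <> 1%E.

(* AR(2) recursion.  With y k = Y_{k+1} (0-based indexing of the innovations),
   (ar2_pair a1 a2 y n) = (X_n, X_{n-1}), where X_n = a1 X_{n-1} + a2 X_{n-2} + Y_n
   for n >= 1 and X_n = 0 for n <= 0. *)
Fixpoint ar2_pair (R : realType) (a1 a2 : R) (y : nat -> R) (n : nat) : R * R :=
  match n with
  | 0 => (0, 0)
  | n'.+1 => let p := ar2_pair a1 a2 y n' in (a1 * p.1 + a2 * p.2 + y n', p.1)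
  end.

Definition ar2 (R : realType) (a1 a2 : R) (y : nat -> R) (n : nat) : R :=
  (ar2_pair a1 a2 y n).1.

(* Survival probability p_N = P(sup_{n=1..N} X_n <= 0), where Y_{k+1} = Y k. *)
Definition survival_prob d (T : measurableType d) (R : realType)
  (P : probability T R) (Y : nat -> {RV P >-> R}) (a1 a2 : R) (N : nat) : R :=
  fine (P [set w | forall n : nat, (1 <= n <= N)%N ->
                     ar2 a1 a2 (fun k => Y k w) n <= 0]).

(* Main.v *)
Require Import Defs.
From HB Require Import structures.
From mathcomp Require Import all_boot all_order all_algebra.
From mathcomp Require Import all_classical all_reals all_analysis.
From mathcomp Require Import measurable_realfun.
From mathcomp Require Import ring lra zify.

(** Write [rho = - a2].  The increments [D_n = X_n - X_{n-1}] satisfy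
    [D_n = rho D_{n-1} + Y_n], and [(1 - rho) X_n = S_n - rho D_n] where [S] is
    the random walk of the innovations.

    For the walk, let [q_n] (resp. [q'_n]) be the probability that
    [S_1, ..., S_n] are all nonpositive (resp. positive), and [Q_n], [Q'_n] the
    sums of the first [n] of these.  Splitting at the first maximum and reversing time
    gives [q_n Q'_n <= 1] and [q'_n Q_n <= 1].  Stopping the martingale [S] at
    its exit time keeps the mean of [|S_n|] on the survival event away from
    [0], while its second moment there is at most [E[Y^2] Q_n]; by
    Cauchy-Schwarz [q_n Q_n >= c] and [q'_n Q'_n >= c].  Together these force
    [q_n] to be of order [1 / Q_n], hence [Q_n] of order [sqrt n] and [q_n] of
    order [1 / sqrt n].  The same second moment bound shows that the walk
    survives and ends below [- eps sqrt n] with probability of order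
    [1 / sqrt n].

    If [a2 = 1], the even and the odd times of [X] are two independent walks.
    If [|a2| < 1], then [D] is bounded by a multiple of the largest innovation,
    so that survival of [X] up to [N] costs at most survival of [S] below a
    level [N^{1/k}]; prefixing a stretch that ends at that depth turns this
    into [q_N].  For the lower bound, survival up to time [m] ending at depth
    [sqrt m] is extended to time [N], of order [m^p], by a surviving stretch of
    the walk with innovations at most of order [sqrt m]; iterating from a fixed
    time costs only a factor [N^{2/p}]. *)

Import Order.TTheory GRing.Theory Num.Theory.
Import numFieldNormedType.Exports.
Local Open Scope classical_set_scope.
Local Open Scope ring_scope.

(** * Laws of i.i.d. sequences *)

Section sequence_space.
Context {R : realType}.

Definition cylinder : set_system (nat -> R) :=
  [set A | exists n B, (forall i, measurable (B i)) /\
     A = [set y : nat -> R | forall i, (i < n)%N -> B i (y i)]].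

Definition seqR : measurableType _ := g_sigma_algebraType cylinder.

Lemma measurable_coord (k : nat) : measurable_fun setT (fun y : seqR => y k).
Proof.
move=> _ B mB; rewrite setTI; apply: sub_sigma_algebra.
exists k.+1, (fun i => if i == k then B else setT); split.
  by move=> i; case: ifP.
apply/seteqP; split => y /=.
  by move=> By i _; case: eqP => // ->.
by move=> /(_ k (ltnSn k)); rewrite eqxx.
Qed.

Lemma measurable_to_seqR d (U : measurableType d) (f : U -> seqR) :
  (forall k, measurable_fun setT (fun u => f u k)) -> measurable_fun setT f.
Proof.
move=> mf; have h : @measurable _ seqR = <<s cylinder >> by [].
have := @measurability _ _ U seqR setT f cylinder h; apply => _ [_ [n [B [mB ->]]] <-].
rewrite setTI.
have -> : f @^-1` [set y | forall i, (i < n)%N -> B i (y i)] =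
  \bigcap_(i in [set i | (i < n)%N]) ((fun u => f u i) @^-1` B i).
  by apply/seteqP; split => u /=.
apply: bigcap_measurableType => i _.
by rewrite -[X in measurable X]setTI; apply: mf.
Qed.

Lemma measurable_box (s : seq nat) (B : nat -> set R) :
  (forall i, measurable (B i)) ->
  measurable ([set y | forall i, i \in s -> B i (y i)] : set seqR).
Proof.
move=> mB.
have -> : [set y : seqR | forall i, i \in s -> B i (y i)] =
  \bigcap_(i in [set` s]) ((fun y : seqR => y i) @^-1` B i).
  by apply/seteqP; split => u /=.
apply: bigcap_measurableType => i _.
by rewrite -[X in measurable X]setTI; apply: measurable_coord.
Qed.

Definition iid_law (nu : probability seqR R) :=
  forall (s : seq nat) (B : nat -> set R),
    uniq s -> (forall i, measurable (B i)) ->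
    nu [set y | forall i, i \in s -> B i (y i)] =
    (\prod_(i <- s) nu [set y | B i (y 0%N)])%E.

Lemma law_unique (m1 m2 : {measure set seqR -> \bar R}) :
  (m1 setT < +oo)%E ->
  (forall n B, (forall i, measurable (B i)) ->
     m1 [set y | forall i, i \in iota 0 n -> B i (y i)] =
     m2 [set y | forall i, i \in iota 0 n -> B i (y i)]) ->
  forall A, measurable A -> m1 A = m2 A.
Proof.
move=> m1T m12 A mA.
apply: (@measure_unique _ R seqR cylinder (fun=> setT)) => //.
- move=> _ _ [n [B [mB ->]]] [n' [B' [mB' ->]]].
  exists (maxn n n'), (fun i => (if (i < n)%N then B i else setT) `&`
                       (if (i < n')%N then B' i else setT)); split.
    by move=> i; apply: measurableI; case: ifP.
  apply/seteqP; split => y /=.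
    by move=> [h h'] i _; split; case: ifP => // H; [exact: h|exact: h'].
  move=> h; split => i ni; have := h i; rewrite leq_max ni ?orbT => /(_ isT) [] //.
- move=> _; exists 0%N, (fun=> setT); split => //.
  by apply/seteqP; split.
- by rewrite bigcup_const.
- move=> _ [n [B [mB ->]]].
  have -> : [set y : seqR | forall i, (i < n)%N -> B i (y i)] =
     [set y | forall i, i \in iota 0 n -> B i (y i)].
    by apply/seteqP; split => y h i; move: (h i); rewrite mem_iota add0n.
  exact: m12.
Qed.

Definition splice (sg : nat -> bool * nat) (p : seqR * seqR) : seqR :=
  fun k => (if (sg k).1 then p.1 else p.2) (sg k).2.

Lemma measurable_splice sg : measurable_fun setT (splice sg).
Proof.
apply: measurable_to_seqR => k; rewrite /splice; case: (sg k).1.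
  apply: (@measurableT_comp _ _ _ _ _ _ (fun y : seqR => y (sg k).2)) => //.
  exact: measurable_coord.
apply: (@measurableT_comp _ _ _ _ _ _ (fun y : seqR => y (sg k).2)) => //.
exact: measurable_coord.
Qed.

(* The left inverse [tau] says that no entry of the two independent copies is
   read twice.  Block independence, time reversal and interleaving are all
   instances. *)
Lemma splice_law (nu : probability seqR R) sg tau : iid_law nu ->
  cancel sg tau ->
  forall A, measurable A -> (nu \x nu)%E (splice sg @^-1` A) = nu A.
Proof.
move=> iid K A mA.

have ms : measurable_fun setT (splice sg) by exact: measurable_splice.
pose ms' := isMeasurableFun.Build _ _ _ _ _ ms.
pose f : {mfun (seqR * seqR)%type >-> seqR} := HB.pack (splice sg) ms'.
apply/esym.
apply: (law_unique nu (pushforward (nu \x nu)%E f)) => //.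
  by have := @probability_setT _ _ _ nu; rewrite /= => ->; exact: ltry.
move=> n B mB; rewrite /pushforward /= iid ?iota_uniq//.
pose s b := [seq (sg i).2 | i <- iota 0 n & (sg i).1 == b].
have us b : uniq (s b).
  rewrite map_inj_in_uniq ?filter_uniq ?iota_uniq// => i j.
  rewrite !mem_filter => /andP[/eqP ib _] /andP[/eqP jb _] ij.
  by apply: (can_inj K); case: (sg i) (sg j) ib jb ij => [? ?] [? ?] /= -> -> ->.
pose C b j := B (tau (b, j)).
have CE i : C (sg i).1 (sg i).2 = B i by rewrite /C -surjective_pairing K.
have E : splice sg @^-1` [set y | forall i, i \in iota 0 n -> B i (y i)] =
   [set y | forall j, j \in s true -> C true j (y j)] `*`
   [set y | forall j, j \in s false -> C false j (y j)].
  apply/seteqP; split => [[y z]|[y z]] /=.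
    move=> h; split => j /mapP[i]; rewrite mem_filter => /andP[/eqP ib iI] ->;
      by have := h _ iI; rewrite /splice -(CE i) ib.
  move=> [h1 h2] i iI; rewrite /splice -(CE i).
  case ib : (sg i).1 => /=; [apply: h1|apply: h2];
    by apply/mapP; exists i => //; rewrite mem_filter ib eqxx.
have mC b : forall j, measurable (C b j) by move=> j; exact: mB.
rewrite {1}/pushforward E product_measure1E; [|exact: measurable_box..].
have I b := iid (s b) (C b) (us b) (mC b).
rewrite [X in _ = (X * _)%E](I true) [X in _ = (_ * X)%E](I false).
rewrite /s !big_map !big_filter (bigID (fun i => (sg i).1 == true))/=.
congr (_ * _)%E.
  by apply: eq_bigr => i /eqP ib; rewrite -(CE i) ib.
apply: eq_big => i; first by case: (sg i).1.
by case ib : (sg i).1 => // _; rewrite -(CE i) ib.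
Qed.

End sequence_space.

Section iid_theory.
Context {R : realType} (nu : probability (@seqR R) R).
Hypothesis iid : iid_law nu.
Local Notation seqR := (@seqR R).

Definition Pr (A : set seqR) : R := fine (nu A).

Lemma PrE A : measurable A -> (Pr A)%:E = nu A.
Proof. by move=> mA; rewrite /Pr fineK// fin_num_measure. Qed.

Definition depends_on_first {U} (m : nat) (F : seqR -> U) :=
  forall y z : seqR, (forall i, (i < m)%N -> y i = z i) -> F y = F z.

Definition drop_first (m : nat) (y : seqR) : seqR := fun k => y (m + k)%N.

Definition glue_idx (m k : nat) : bool * nat :=
  if (k < m)%N then (true, k) else (false, k - m)%N.

Lemma glue_idxK m : cancel (glue_idx m)
  (fun p => if p.1 then p.2 else (m + p.2)%N).
Proof. by move=> k; rewrite /glue_idx; case: ltnP => //= mk; rewrite subnKC. Qed.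

Lemma glue_first {U} m (F : seqR -> U) p : depends_on_first m F ->
  F (splice (glue_idx m) p) = F p.1.
Proof. by move=> dF; apply: dF => i im; rewrite /splice /glue_idx im. Qed.

Lemma drop_first_glue m p : drop_first m (splice (glue_idx m) p) = p.2.
Proof.
apply/funext => k.
by rewrite /drop_first /splice /glue_idx ltnNge leq_addr/= addKn.
Qed.

Lemma measurable_drop_first m : measurable_fun setT (drop_first m).
Proof. by apply: measurable_to_seqR => k; exact: measurable_coord. Qed.

Lemma Pr_drop_first_indep m A B : measurable A -> measurable B ->
  depends_on_first m A -> Pr (A `&` drop_first m @^-1` B) = Pr A * Pr B.
Proof.
move=> mA mB dA; apply: EFin_inj; rewrite EFinM.
have mAB : measurable (A `&` drop_first m @^-1` B).
  apply: measurableI => //; rewrite -[X in measurable X]setTI.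
  exact: measurable_drop_first.
rewrite !PrE// -(splice_law _ _ _ iid (glue_idxK m))//.
rewrite -product_measure1E//; congr ((nu \x nu)%E _).
apply/seteqP; split => p /=; rewrite drop_first_glue (glue_first _ A)//.
Qed.

Definition rev_first (n : nat) (y : seqR) : seqR :=
  fun k => y (if (k < n)%N then n.-1 - k else k)%N.

Lemma measurable_rev_first n : measurable_fun setT (rev_first n).
Proof. by apply: measurable_to_seqR => k; exact: measurable_coord. Qed.

Lemma Pr_rev_first n A : measurable A -> Pr (rev_first n @^-1` A) = Pr A.
Proof.
move=> mA; apply: EFin_inj.
have mrA : measurable (rev_first n @^-1` A).
  by rewrite -[X in measurable X]setTI; exact: measurable_rev_first.
rewrite !PrE//.
pose r k := (if (k < n)%N then n.-1 - k else k)%N.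
have rK : cancel (fun k => (true, r k)) (fun p => r p.2).
  by move=> k; rewrite /r /=; do 2 case: ifP; lia.
rewrite -[RHS](splice_law _ _ _ iid rK)//.
have -> : splice (fun k => (true, r k)) @^-1` A =
   (rev_first n @^-1` A) `*` setT by apply/seteqP; split => p //= [].
rewrite product_measure1E//.
by rewrite [X in (_ * X)%E]probability_setT mule1.
Qed.

Lemma Pr_interleave (A B : set seqR) : measurable A -> measurable B ->
  Pr [set y : seqR | A (fun k => y k.*2) /\ B (fun k => y k.*2.+1)] =
  Pr A * Pr B.
Proof.
move=> mA mB; apply: EFin_inj; rewrite EFinM.
pose sg k := (~~ odd k, k./2).
have K : cancel sg (fun p => if p.1 then p.2.*2 else p.2.*2.+1).
  by move=> k; rewrite /sg /=; case: ifP; lia.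
have ev p : (fun k => splice sg p k.*2) = p.1.
  by apply/funext => k; rewrite /splice /sg /= odd_double doubleK.
have od p : (fun k => splice sg p k.*2.+1) = p.2.
  by apply/funext => k; rewrite /splice /sg /= odd_double uphalf_double.
have mAB : measurable ([set y | A (fun k => y k.*2) /\ B (fun k => y k.*2.+1)] : set seqR).
  apply: measurableI; rewrite -[X in measurable X]setTI.
    have /(_ measurableT A mA) // : measurable_fun setT ((fun y k => y k.*2) : seqR -> seqR).
    by apply: measurable_to_seqR => k; exact: measurable_coord.
  have /(_ measurableT B mB) // : measurable_fun setT ((fun y k => y k.*2.+1) : seqR -> seqR).
  by apply: measurable_to_seqR => k; exact: measurable_coord.
rewrite !PrE// -(splice_law _ _ _ iid K)//.
rewrite -product_measure1E//; congr ((nu \x nu)%E _).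
by apply/seteqP; split => p /=; rewrite ev od.
Qed.

End iid_theory.

Section product_integral.
Context d1 d2 (T1 : measurableType d1) (T2 : measurableType d2) (R : realType).
Variables (m1 : {sigma_finite_measure set T1 -> \bar R})
          (m2 : {sigma_finite_measure set T2 -> \bar R}).
Variables (F : T1 -> R) (G : T2 -> R).
Hypotheses (iF : m1.-integrable setT (EFin \o F))
           (iG : m2.-integrable setT (EFin \o G)).

Let mF : measurable_fun setT F.
Proof. by apply/measurable_EFinP; case/integrableP : iF. Qed.

Let mG : measurable_fun setT G.
Proof. by apply/measurable_EFinP; case/integrableP : iG. Qed.

Lemma integrable_prodM :
  (m1 \x m2)%E.-integrable setT (fun p => (F p.1 * G p.2)%:E).
Proof.
have mFG : measurable_fun setT (fun p : T1 * T2 => (F p.1 * G p.2)%:E).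
  apply/measurable_EFinP; apply: measurable_funM.
    exact: measurableT_comp.
  exact: measurableT_comp.
apply/(integrable12ltyP m1 m2 mFG).
have -> : (\int[m1]_x \int[m2]_y `|(F (x, y).1 * G (x, y).2)%:E| =
  \int[m1]_x (`|(F x)%:E| * \int[m2]_y `|(G y)%:E|))%E.
  apply: eq_integral => x _; rewrite -ge0_integralZl//.
  - by apply: eq_integral => y _ /=; rewrite normrM EFinM.
  - by do 2 apply: measurableT_comp => //.
have [_ G1] := integrableP _ _ _ iG; have [_ F1] := integrableP _ _ _ iF.
have Gfin : (\int[m2]_y `|(G y)%:E|)%E \is a fin_num.
  by rewrite ge0_fin_numE//; apply: integral_ge0.
rewrite -(fineK Gfin) ge0_integralZr//.
- apply: lte_mul_pinfty => //; first exact: integral_ge0.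
  rewrite ge0_fin_numE//; exact: integral_ge0.
  by rewrite ltry.
- by do 2 apply: measurableT_comp => //.
- by rewrite lee_fin fine_ge0// integral_ge0.
Qed.

Lemma Rintegral_prodM : (\int[(m1 \x m2)%E]_p (F p.1 * G p.2) =
  \int[m1]_x F x * \int[m2]_y G y)%R.
Proof.
rewrite /Rintegral -(integral12_prod_meas1 integrable_prodM) /fubini_F /=.
have Gfin := integrable_fin_num measurableT iG.
have Ffin := integrable_fin_num measurableT iF.
have -> : (\int[m1]_x \int[m2]_y (F x * G y)%:E =
           \int[m1]_x ((F x)%:E * \int[m2]_y (G y)%:E))%E.
  apply: eq_integral => x _; rewrite -integralZl//.
rewrite -(fineK Gfin) integralZr// fineM//=.
Qed.

End product_integral.

Section iid_expectation.
Context {R : realType} (nu : probability (@seqR R) R).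
Hypothesis iid : iid_law nu.
Local Notation seqR := (@seqR R).

Section next_coord.
Variables (m : nat) (F : seqR -> R) (g : R -> R).
Hypotheses (mg : measurable_fun setT g) (dF : depends_on_first m F).
Hypotheses (iF : nu.-integrable setT (EFin \o F))
  (ig : nu.-integrable setT (EFin \o (fun y : seqR => g (y 0%N)))).

Let f (y : seqR) := F y * g (y m).

Let mf : measurable_fun setT (EFin \o f).
Proof.
apply/measurable_EFinP; apply: measurable_funM.
  by apply/measurable_EFinP; case/integrableP : iF.
apply: measurableT_comp => //; exact: measurable_coord.
Qed.

Let S : {mfun (seqR * seqR)%type >-> seqR} :=
  HB.pack (splice (glue_idx m)) (isMeasurableFun.Build _ _ _ _ _ (measurable_splice (glue_idx m))).

Let nuE A : measurable A -> A `<=` setT -> pushforward (nu \x nu)%E S A = nu A.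
Proof. by move=> mA _; rewrite -(splice_law _ _ _ iid (glue_idxK m)). Qed.

Let fS : (EFin \o f) \o S = fun p => (F p.1 * g (p.2 0%N))%:E.
Proof.
apply/funext => p; rewrite /= /f glue_first//; congr (_ * g _)%:E.
by rewrite /splice /glue_idx ltnn subnn.
Qed.

Let iS : ((nu \x nu)%E).-integrable setT ((EFin \o f) \o S).
Proof. by rewrite fS; exact: (integrable_prodM _ _ _ _ _ _ _ _ _ iF ig). Qed.

Lemma integrable_next : nu.-integrable setT (EFin \o (fun y => F y * g (y m))).
Proof.
have := @integrable_pushforward _ _ _ _ R S (measurable_funPT S) (nu \x nu)%E setT _ mf iS measurableT.
move=> /integrableP[_ h]; apply/integrableP; split => //.
move: h; rewrite (eq_measure_integral nu)//; exact: nuE.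
Qed.

Lemma Rintegral_next :
  \int[nu]_y (F y * g (y m)) = \int[nu]_y F y * \int[nu]_y g (y 0%N).
Proof.
rewrite -(Rintegral_prodM _ _ _ _ _ _ _ _ _ iF ig) /Rintegral; congr fine.
transitivity (\int[pushforward (nu \x nu)%E S]_y (EFin \o f) y)%E.
  by apply: eq_measure_integral => A mA ?; rewrite -[LHS]nuE.
by rewrite integral_pushforward// preimage_setT fS.
Qed.

End next_coord.
End iid_expectation.

(** * Random walks killed outside a half-line *)

Section random_walk.
Context {R : realType} (nu : probability (@seqR R) R).
Hypothesis iid : iid_law nu.
Local Notation seqR := (@seqR R).
Local Notation Pr := (Pr nu).

Local Notation integ f := (nu.-integrable setT (EFin \o f)).
Local Notation E f := (Rintegral nu setT f).

Lemma integ_measurable (f : seqR -> R) : integ f -> measurable_fun setT f.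
Proof. by move=> /integrableP[/measurable_EFinP]. Qed.

Lemma integD (f g : seqR -> R) : integ f -> integ g -> integ (fun y => f y + g y).
Proof. by move=> hf hg; exact: (integrableD measurableT hf hg). Qed.

Lemma integZ c (f : seqR -> R) : integ f -> integ (fun y => c * f y).
Proof. by move=> hf; exact: (integrableZl measurableT c hf). Qed.

Lemma integ_indic (A : set seqR) : measurable A -> integ (\1_A : seqR -> R).
Proof. by move=> mA; exact: integrable_indic. Qed.

Lemma integM_indic (f : seqR -> R) A : measurable A -> integ f ->
  integ (fun y => f y * \1_A y).
Proof.
move=> mA hf; apply: (le_integrable measurableT _ _ hf).
  apply/measurable_EFinP; apply: measurable_funM => //.
  exact: integ_measurable.
move=> y _; rewrite lee_fin normrM ler_piMr// indicE.
by case: (_ \in _); rewrite ?normr1 ?normr0.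
Qed.

Lemma indic_in (A : set seqR) y : A y -> \1_A y = 1 :> R.
Proof. by move=> Ay; rewrite indicE mem_set. Qed.

Lemma indic_notin (A : set seqR) y : ~ A y -> \1_A y = 0 :> R.
Proof. by move=> Ay; rewrite indicE memNset. Qed.

Lemma E_indic (A : set seqR) : measurable A -> E (\1_A : seqR -> R) = Pr A.
Proof. by move=> mA; rewrite /Rintegral integral_indic// setIT. Qed.

Lemma Pr_ge0 A : 0 <= Pr A.
Proof. exact: fine_ge0. Qed.

Lemma le_Pr (A B : set seqR) : measurable A -> measurable B -> A `<=` B ->
  Pr A <= Pr B.
Proof.
move=> mA mB AB; rewrite -lee_fin !PrE//.
by apply: le_measure => //; rewrite inE.
Qed.

Lemma Pr_le1 A : measurable A -> Pr A <= 1.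
Proof. by move=> mA; rewrite -lee_fin PrE// probability_le1. Qed.

Lemma PrT : Pr setT = 1.
Proof.
by rewrite -[Pr setT]/(fine (nu setT)) probability_setT.
Qed.

Definition walk (n : nat) (y : seqR) : R := \sum_(i < n) y i.

Lemma walk0 y : walk 0 y = 0. Proof. by rewrite /walk big_ord0. Qed.

Lemma walkS n y : walk n.+1 y = walk n y + y n.
Proof. by rewrite /walk big_ord_recr. Qed.

Lemma walkD m n y : walk (m + n) y = walk m y + walk n (drop_first m y).
Proof.
elim: n => [|n IH]; first by rewrite addn0 walk0 addr0.
by rewrite addnS !walkS IH addrA.
Qed.

Lemma walk_depends n : depends_on_first n (walk n).
Proof. by move=> y z yz; apply: eq_bigr => i _; exact: yz. Qed.

Lemma measurable_walk n : measurable_fun setT (walk n).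
Proof. by apply: measurable_sum => i; exact: measurable_coord. Qed.

Lemma measurable_norm_walk_gt h n :
  measurable ([set y | h < `|walk n y|] : set seqR).
Proof.
rewrite -[X in measurable X]setTI.
have -> : [set y | h < `|walk n y|] = (fun y => `|walk n y|) @^-1` `]h, +oo[.
  by apply/seteqP; split => y /=; rewrite in_itv/= andbT.
have mw : measurable_fun setT (fun y => `|walk n y|).
  by apply: measurableT_comp => //; exact: measurable_walk.
exact: mw.
Qed.

Definition stay (G : set R) n : set seqR :=
  [set y | forall i, (1 <= i <= n)%N -> G (walk i y)].

Lemma measurable_stay G n : measurable G -> measurable (stay G n).
Proof.
move=> mG.
have -> : stay G n = \bigcap_(i in [set i | (1 <= i <= n)%N]) (walk i @^-1` G).
  by apply/seteqP; split.
apply: bigcap_measurableType => i _.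
by rewrite -[X in measurable X]setTI; exact: measurable_walk.
Qed.

Lemma stay_depends G n : depends_on_first n (stay G n).
Proof.
move=> y z yz; apply/propext; split => h i /[dup] /andP[_ i2] /h;
  by rewrite (walk_depends i y z)// => j ji; apply: yz; exact: leq_trans i2.
Qed.

Lemma stay_sub G m n : (m <= n)%N -> stay G n `<=` stay G m.
Proof.
by move=> mn y h i /andP[i1 im]; apply: h; rewrite i1 (leq_trans im).
Qed.

Lemma staySE G n y : stay G n.+1 y <-> stay G n y /\ G (walk n.+1 y).
Proof.
split=> [h|[h1 h2] i /andP[i1]].
  by split; [exact: (stay_sub G n n.+1 _ _ h)|apply: h; rewrite leqnn].
rewrite leq_eqVlt => /orP[/eqP -> //|]; rewrite ltnS => i2.
by apply: h1; rewrite i1.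
Qed.

Definition surv (G : set R) n : R := Pr (stay G n).

Lemma surv0 G : surv G 0 = 1.
Proof.
rewrite /surv (_ : stay G 0 = setT) ?PrT//.
apply/seteqP; split => // y _ i; lia.
Qed.

Lemma surv_ge0 G n : 0 <= surv G n. Proof. exact: Pr_ge0. Qed.

Lemma surv_le G m n : measurable G -> (m <= n)%N -> surv G n <= surv G m.
Proof.
by move=> mG mn; apply: le_Pr; [exact: measurable_stay..|exact: stay_sub].
Qed.

Section moments.
Local Notation Y0 := (fun y : seqR => y 0%N).
Hypotheses (i1 : integ Y0) (i2 : integ (fun y : seqR => y 0%N ^+ 2)).
Hypothesis (EY0 : E Y0 = 0).
Definition var0 : R := E (fun y : seqR => y 0%N ^+ 2).

Lemma var0_ge0 : 0 <= var0.
Proof. by apply: Rintegral_ge0 => // y _; exact: sqr_ge0. Qed.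

Lemma depends_indic n (A : set seqR) : depends_on_first n A ->
  depends_on_first n (\1_A : seqR -> R).
Proof.
move=> dA y z yz; rewrite !indicE; congr (_%:R); congr nat_of_bool.
by apply/idP/idP; rewrite !inE (dA y z yz).
Qed.

Lemma integ_walk n : integ (walk n).
Proof.
elim: n => [|n IH].
  have -> : walk 0 = (fun y => 0 * \1_setT y) :> (seqR -> R).
    by apply/funext => y; rewrite walk0 mul0r.
  exact/integZ/integ_indic.
have -> : walk n.+1 = (fun y => walk n y + \1_setT y * y n).
  by apply/funext => y; rewrite walkS indicT mul1r.
apply: integD => //; apply: (integrable_next nu iid n _ id) => //.
exact: integ_indic.
Qed.

Lemma integ_walk_sqr n : integ (fun y => walk n y ^+ 2).
Proof.
elim: n => [|n IH].
  have -> : (fun y => walk 0 y ^+ 2) = (fun y => 0 * \1_setT y) :> (seqR -> R).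
    by apply/funext => y; rewrite walk0 mul0r expr0n.
  exact/integZ/integ_indic.
have -> : (fun y => walk n.+1 y ^+ 2) =
  (fun y => (walk n y ^+ 2 + 2 * (walk n y * y n)) + \1_setT y * y n ^+ 2).
  by apply/funext => y; rewrite walkS indic_in//; ring.
apply: integD; last first.
  apply: (integrable_next nu iid n _ (fun x => x ^+ 2)) => //.
  exact: integ_indic.
apply: integD => //; apply: integZ; apply: (integrable_next nu iid n _ id) => //.
  exact: walk_depends.
exact: integ_walk.
Qed.

Lemma E_walkS n (A : set seqR) : measurable A -> depends_on_first n A ->
  E (fun y => walk n.+1 y * \1_A y) = E (fun y => walk n y * \1_A y).
Proof.
move=> mA dA.
have -> : (fun y => walk n.+1 y * \1_A y) =
   (fun y => walk n y * \1_A y + \1_A y * y n).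
  by apply/funext => y; rewrite walkS; ring.
rewrite RintegralD//.
- rewrite (Rintegral_next nu iid n (\1_A) id)//.
  + by rewrite EY0 mulr0 addr0.
  + exact: depends_indic.
  + exact: integ_indic.
- by apply: integM_indic => //; exact: integ_walk.
- apply: (integrable_next nu iid n _ id) => //.
    exact: depends_indic.
  exact: integ_indic.
Qed.

Lemma E_walkS_sqr n (A : set seqR) : measurable A -> depends_on_first n A ->
  E (fun y => walk n.+1 y ^+ 2 * \1_A y) =
  E (fun y => walk n y ^+ 2 * \1_A y) + var0 * Pr A.
Proof.
move=> mA dA.
have -> : (fun y => walk n.+1 y ^+ 2 * \1_A y) =
   (fun y => (walk n y ^+ 2 * \1_A y + 2 * ((walk n y * \1_A y) * y n)) +
     \1_A y * y n ^+ 2).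
  by apply/funext => y; rewrite walkS; ring.
have iw : integ (fun y => walk n y * \1_A y).
  by apply: integM_indic => //; exact: integ_walk.
have dw : depends_on_first n (fun y => walk n y * \1_A y).
  by move=> y z yz; rewrite (walk_depends n y z)// (depends_indic n A dA y z).
have iwy : integ (fun y => (walk n y * \1_A y) * y n).
  exact: (integrable_next nu iid n _ id).
have iy2 : integ (fun y => \1_A y * y n ^+ 2).
  apply: (integrable_next nu iid n _ (fun x => x ^+ 2)) => //.
    exact: depends_indic.
  exact: integ_indic.
have iw2 : integ (fun y => walk n y ^+ 2 * \1_A y).
  by apply: integM_indic => //; exact: integ_walk_sqr.
rewrite RintegralD//; last by apply: integD => //; exact: integZ.
rewrite RintegralD//; last exact: integZ.
rewrite RintegralZl// (Rintegral_next nu iid n _ id)// EY0 !mulr0 addr0.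
congr (_ + _).
rewrite (Rintegral_next nu iid n (\1_A) (fun x => x ^+ 2))//.
- by rewrite E_indic// mulrC.
- exact: depends_indic.
- exact: integ_indic.
Qed.

Section barrier.
Variables (G : set R) (e : R).
Hypotheses (mG : measurable G) (eG : forall x, ~ G x -> 0 <= e * x).
Hypothesis (e1 : `|e| = 1).

Definition drift0 : R := - e * E (fun y => y 0%N * \1_(stay G 1) y).

Lemma E_walk_stay n : (0 < n)%N ->
  drift0 <= - e * E (fun y => walk n y * \1_(stay G n) y).
Proof.
elim: n => // -[_ _|n IH _].
  rewrite le_eqVlt; apply/orP; left; apply/eqP; congr (_ * _).
  by apply: eq_Rintegral => y _; rewrite walkS walk0 add0r.
apply: (le_trans (IH _)) => //.
rewrite -[in leLHS]E_walkS//; [|exact: measurable_stay|exact: stay_depends].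
rewrite -!RintegralZl//; [|by apply: integM_indic; [exact: measurable_stay|exact: integ_walk]..].
apply: le_Rintegral => //.
- by apply: integZ; apply: integM_indic; [exact: measurable_stay|exact: integ_walk].
- by apply: integZ; apply: integM_indic; [exact: measurable_stay|exact: integ_walk].
move=> y _.
case: (pselect (stay G n.+1 y)) => h1; last first.
  rewrite (indic_notin _ _ h1) indic_notin//.
  by move=> h; apply: h1; exact: (stay_sub G n.+1 n.+2 _ _ h).
case: (pselect (stay G n.+2 y)) => h2; first by rewrite !indic_in.
rewrite (indic_in _ _ h1) (indic_notin _ _ h2) !mulr0 mulr1.
rewrite mulNr oppr_le0; apply: eG => h3; apply: h2; exact/staySE.
Qed.

Lemma E_walk_sqr_stay n :
  E (fun y => walk n y ^+ 2 * \1_(stay G n) y) <= var0 * \sum_(k < n) surv G k.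
Proof.
elim: n => [|n IH].
  rewrite big_ord0 mulr0 le_eqVlt; apply/orP; left; apply/eqP.
  rewrite (_ : (fun y => _) = cst 0) ?Rintegral_cst// ?mul0r//.
  by apply/funext => y; rewrite walk0 expr0n mul0r.
rewrite big_ord_recr /= mulrDr.
apply: (@le_trans _ _ (E (fun y => walk n.+1 y ^+ 2 * \1_(stay G n) y))).
  apply: le_Rintegral => //.
  - by apply: integM_indic; [exact: measurable_stay|exact: integ_walk_sqr].
  - by apply: integM_indic; [exact: measurable_stay|exact: integ_walk_sqr].
  move=> y _; rewrite ler_wpM2l ?sqr_ge0//.
  case: (pselect (stay G n.+1 y)) => h1; last by rewrite (indic_notin _ _ h1).
  by rewrite !indic_in//; apply: (stay_sub G n n.+1 _ _ h1).
rewrite E_walkS_sqr//; [|exact: measurable_stay|exact: stay_depends].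
by rewrite lerD2r.
Qed.

(* AM-GM in the form |w| <= t w^2 / 2 + 1 / (2 t), used where |w| > h. *)
Lemma drift0_le n h t : (0 < n)%N -> 0 <= h -> 0 < t ->
  drift0 <= h * surv G n + t / 2 * (var0 * \sum_(k < n) surv G k) +
    (2 * t)^-1 * Pr (stay G n `&` [set y | h < `|walk n y|]).
Proof.
move=> n0 h0 t0.
apply: (le_trans (E_walk_stay n n0)).
have mS := measurable_stay G n mG.
have mSh : measurable (stay G n `&` [set y | h < `|walk n y|]).
  by apply: measurableI => //; exact: measurable_norm_walk_gt.
apply: (@le_trans _ _ (h * surv G n + t / 2 * E (fun y => walk n y ^+ 2 * \1_(stay G n) y) +
   (2 * t)^-1 * Pr (stay G n `&` [set y | h < `|walk n y|]))); last first.
  rewrite lerD2r lerD2l; apply: ler_wpM2l; first by rewrite divr_ge0// ltW.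
  exact: E_walk_sqr_stay.
have iw : integ (fun y => walk n y * \1_(stay G n) y).
  by apply: integM_indic => //; exact: integ_walk.
have iw2 : integ (fun y => walk n y ^+ 2 * \1_(stay G n) y).
  by apply: integM_indic => //; exact: integ_walk_sqr.
rewrite /surv -!E_indic// -!RintegralZl//; [|exact: integ_indic..].
rewrite -!RintegralD//.
- apply: le_Rintegral => //.
  + exact: integZ.
  + by repeat apply: integD; apply: integZ => //; exact: integ_indic.
  move=> y _.
  have w0 : - e * walk n y <= `|walk n y|.
    by apply: (le_trans (ler_norm _)); rewrite normrM normrN e1 mul1r.
  have tw : 0 <= t / 2 * walk n y ^+ 2 by rewrite mulr_ge0 ?sqr_ge0 ?divr_ge0 ?ltW.
  case: (pselect (stay G n y)) => h1; last first.
    rewrite !indicE (memNset h1) memNset; last by case.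
    by rewrite !(mulr0, addr0).
  rewrite !indicE (mem_set h1) !mulr1.
  apply: (le_trans w0).
  case: (ltP h `|walk n y|) => hw; last first.
    rewrite memNset ?mulr0 ?addr0; first lra.
    by move=> [_ /=]; rewrite ltNge hw.
  rewrite mem_set// mulr1 -[X in _ + _ * X + _]real_normK ?num_real//.
  set w := `|_|; rewrite -subr_ge0.
  have -> : h + t / 2 * w ^+ 2 + (2 * t)^-1 - w = h + (2 * t)^-1 * (t * w - 1) ^+ 2.
    by field; rewrite gt_eqF.
  by rewrite addr_ge0// mulr_ge0 ?sqr_ge0// invr_ge0; lra.
- by apply: integD; apply: integZ => //; exact: integ_indic.
- by apply: integZ; exact: integ_indic.
- by apply: integZ; exact: integ_indic.
- exact: integZ.
Qed.

End barrier.
End moments.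
End random_walk.

(** * Persistence of the walk is of order the inverse square root *)

Lemma renewal_sqrt {R : realType} (q q' : nat -> R) (c : R) : 0 < c ->
  (forall n, 0 <= q n <= 1) -> (forall n, 0 <= q' n) -> q 0%N = 1 ->
  (forall n, (0 < n)%N -> c <= q n * \sum_(k < n) q k) ->
  (forall n, (0 < n)%N -> c <= q' n * \sum_(k < n) q' k) ->
  (forall n, (0 < n)%N -> q n * \sum_(k < n) q' k <= 1) ->
  (forall n, (0 < n)%N -> q' n * \sum_(k < n) q k <= 1) ->
  exists c1 C1 : R, [/\ 0 < c1, 0 < C1 & forall n, (0 < n)%N ->
    [/\ c1 / Num.sqrt n%:R <= q n, q n <= C1 / Num.sqrt n%:R &
        \sum_(k < n) q k <= C1 * Num.sqrt n%:R]].
Proof.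
move=> c0 q01 q'0 q1 cq cq' qq' q'q.
pose Q n := \sum_(k < n) q k; pose Q' n := \sum_(k < n) q' k.
have Q0 n : 0 <= Q n by apply: sumr_ge0 => i _; case/andP: (q01 i).
have Q'0 n : 0 <= Q' n by apply: sumr_ge0 => i _.
have up n : (0 < n)%N -> q n * Q n <= c^-1.
  move=> n0; rewrite -[leRHS]mul1r ler_pdivlMr//.
  have [qn0 qn1] := andP (q01 n).
  apply: (@le_trans _ _ ((q n * Q' n) * (q' n * Q n))).
    have -> : (q n * Q' n) * (q' n * Q n) = (q n * Q n) * (q' n * Q' n) by ring.
    by apply: ler_wpM2l; [exact: mulr_ge0|exact: cq'].
  by rewrite -[leRHS]mulr1; apply: ler_pM; rewrite ?mulr_ge0//; [exact: qq'|exact: q'q].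
have QS n : Q n.+1 = Q n + q n by rewrite /Q big_ord_recr.
have Q1 : Q 1%N = 1 by rewrite QS /Q big_ord0 q1 add0r.
have c1 : c <= 1.
  have := cq 1%N isT; rewrite -/(Q 1%N) Q1 mulr1 => /le_trans; apply.
  by case/andP: (q01 1%N).
pose C := 2 * c^-1 + 1.
have C0 : 1 < C by rewrite /C ltrDr mulr_gt0// invr_gt0.
have Qlo n : (0 < n)%N -> c * n%:R <= Q n ^+ 2.
  elim: n => // -[_ _|n IH _]; first by rewrite Q1 expr1n mulr1.
  rewrite QS -natr1 mulrDr mulr1 sqrrD.
  have := IH isT; have := cq n.+1 isT; rewrite -/(Q n.+1) => h1 h2.
  have h3 : 0 <= q n.+1 ^+ 2 by exact: sqr_ge0.
  rewrite mulrC in h1; rewrite -mulr_natl; lra.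
have Qhi n : (0 < n)%N -> Q n ^+ 2 <= C * n%:R.
  elim: n => // -[_ _|n IH _]; first by rewrite Q1 expr1n mulr1 ltW.
  rewrite QS -natr1 mulrDr mulr1 sqrrD.
  have := IH isT; have := up n.+1 isT => h1 h2.
  have h3 : q n.+1 ^+ 2 <= 1.
    by case/andP: (q01 n.+1) => ? ?; rewrite expr_le1.
  rewrite mulrC in h1; rewrite -mulr_natl /C in h2 *; lra.
have sc : 0 < Num.sqrt c by rewrite sqrtr_gt0.
have sC : 0 < Num.sqrt C by rewrite sqrtr_gt0; apply: lt_trans C0.
have Qlo' n : (0 < n)%N -> Num.sqrt c * Num.sqrt n%:R <= Q n.
  move=> n0; rewrite -sqrtrM; last exact: ltW.
  rewrite -[X in _ <= X]ger0_norm// -sqrtr_sqr.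
  by apply: ler_wsqrtr; exact: Qlo.
have Qhi' n : (0 < n)%N -> Q n <= Num.sqrt C * Num.sqrt n%:R.
  move=> n0; rewrite -sqrtrM; last by apply: le_trans (ltW C0).
  rewrite -[X in X <= _]ger0_norm// -sqrtr_sqr.
  by apply: ler_wsqrtr; exact: Qhi.
exists (c / Num.sqrt C), (Num.sqrt C + c^-1 / Num.sqrt c); split.
- exact: divr_gt0.
- by rewrite addr_gt0// divr_gt0// invr_gt0.
move=> n n0; have sn : 0 < Num.sqrt n%:R :> R by rewrite sqrtr_gt0 ltr0n.
have Qn : 0 < Q n by apply: lt_le_trans (Qlo' _ n0); exact: mulr_gt0.
split.
- rewrite -mulrA -invfM; apply: (@le_trans _ _ (c / Q n)).
    rewrite ler_pM2l// lef_pV2 ?posrE ?mulr_gt0//; exact: Qhi'.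
  by rewrite ler_pdivrMr//; exact: cq.
- apply: (@le_trans _ _ (c^-1 / Q n)).
    by rewrite ler_pdivlMr//; exact: up.
  apply: (@le_trans _ _ (c^-1 / (Num.sqrt c * Num.sqrt n%:R))).
    rewrite ler_pM2l ?invr_gt0// lef_pV2 ?posrE ?mulr_gt0//; exact: Qlo'.
  rewrite invfM mulrA ler_pM2r ?invr_gt0// lerDr ltW//.
- apply: (le_trans (Qhi' _ n0)); rewrite ler_pM2r// lerDl.
  by rewrite divr_ge0// ?invr_ge0 ltW.
Qed.

Section walk_survival.
Context {R : realType} (nu : probability (@seqR R) R).
Hypothesis iid : iid_law nu.
Local Notation seqR := (@seqR R).
Local Notation Pr := (Pr nu).
Local Notation stay := (@stay R).
Local Notation walk := (@walk R).

Definition nonpos : set R := [set x | x <= 0].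
Definition positive : set R := [set x | 0 < x].

Lemma measurable_nonpos : measurable nonpos.
Proof.
rewrite (_ : nonpos = `]-oo, 0]%classic); first exact: measurable_itv.
by apply/seteqP; split => x; rewrite /nonpos /= in_itv.
Qed.

Lemma measurable_positive : measurable positive.
Proof.
rewrite (_ : positive = `]0, +oo[%classic); first exact: measurable_itv.
by apply/seteqP; split => x; rewrite /positive /= in_itv/= andbT.
Qed.

Lemma walk_rev_first k i y : (i <= k)%N ->
  walk i (rev_first k y) = walk k y - walk (k - i) y.
Proof.
elim: i => [|i IH] ik; first by rewrite walk0 subn0 subrr.
rewrite walkS IH ?(ltnW ik)// /rev_first ik.
have -> : (k - i = (k - i.+1).+1)%N by lia.
rewrite walkS; have -> : (k.-1 - i = k - i.+1)%N by lia.
by ring.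
Qed.

(* The walk up to time [n] attains its maximum for the first time at [k]. *)
Definition argmax n k : set seqR :=
  rev_first k @^-1` stay positive k `&` drop_first k @^-1` stay nonpos (n - k).

Lemma measurable_argmax n k : measurable (argmax n k).
Proof.
apply: measurableI; rewrite -[X in measurable X]setTI.
  by apply: measurable_rev_first => //; apply: measurable_stay; exact: measurable_positive.
by apply: measurable_drop_first => //; apply: measurable_stay; exact: measurable_nonpos.
Qed.

Lemma argmax_disjoint n k l y : (k < l <= n)%N -> argmax n k y -> argmax n l y -> False.
Proof.
move=> /andP[kl ln] [_ /(_ (l - k)%N) h1] [/(_ (l - k)%N) h2 _].
have : 0 < walk (l - k) (rev_first l y) by apply: h2; lia.
rewrite walk_rev_first ?leq_subr// subKn; last exact: ltnW.
have : walk (l - k) (drop_first k y) <= 0 by apply: h1; lia.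
have -> : walk l y = walk k y + walk (l - k) (drop_first k y).
  by rewrite -walkD subnKC// ltnW.
by rewrite addrAC subrr add0r => h3 /lt_geF; rewrite h3.
Qed.

Lemma Pr_argmax n k : (k <= n)%N ->
  Pr (argmax n k) = surv nu positive k * surv nu nonpos (n - k).
Proof.
move=> kn; rewrite /argmax (Pr_drop_first_indep nu iid).
- by rewrite (Pr_rev_first nu iid)//; apply: measurable_stay; exact: measurable_positive.
- rewrite -[X in measurable X]setTI; apply: measurable_rev_first => //.
  by apply: measurable_stay; exact: measurable_positive.
- by apply: measurable_stay; exact: measurable_nonpos.
- move=> y z yz; rewrite /preimage/=; apply: stay_depends => i ik.
  by rewrite /rev_first ik; apply: yz; lia.
Qed.

Lemma argmax_sum n :
  \sum_(k < n.+1) surv nu positive k * surv nu nonpos (n - k) <= 1.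
Proof.
have -> : \sum_(k < n.+1) surv nu positive k * surv nu nonpos (n - k) =
  \sum_(k < n.+1) Pr (argmax n k).
  by apply: eq_bigr => k _; rewrite Pr_argmax// -ltnS.
rewrite -lee_fin -sumEFin.
rewrite (eq_bigr (fun k : 'I_n.+1 => nu (argmax n k))); last first.
  by move=> k _; rewrite PrE//; exact: measurable_argmax.
rewrite -measure_semi_additive_ord.
- apply: probability_le1; apply: bigsetU_measurable => i _; exact: measurable_argmax.
- by move=> k; exact: measurable_argmax.
- apply/trivIsetP => i j _ _ ij; apply/seteqP; split => // y [yi yj].
  have [lt|lt|eq] := ltngtP i j.
  + by apply: (argmax_disjoint n i j y) => //; rewrite lt -ltnS ltn_ord.
  + by apply: (argmax_disjoint n j i y) => //; rewrite lt -ltnS ltn_ord.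
  + by move: ij; rewrite (val_inj eq) eqxx.
- by apply: bigsetU_measurable => i _; exact: measurable_argmax.
Qed.

Lemma surv_sum_le n : (0 < n)%N ->
  surv nu nonpos n * \sum_(k < n) surv nu positive k <= 1 /\
  surv nu positive n * \sum_(k < n) surv nu nonpos k <= 1.
Proof.
case: n => // n _.
have mp := measurable_positive; have mn := measurable_nonpos.
split; apply: (le_trans _ (argmax_sum n)); rewrite mulr_sumr.
  apply: ler_sum => k _; rewrite mulrC ler_wpM2l ?surv_ge0//.
  by apply: surv_le => //; rewrite (leq_trans (leq_subr _ _)).
rewrite (reindex_inj rev_ord_inj)/=; apply: ler_sum => k _.
rewrite subSS ler_wpM2r ?surv_ge0//; apply: surv_le => //.
by rewrite ltnW.
Qed.

Local Notation integ f := (nu.-integrable setT (EFin \o f)).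
Local Notation E f := (Rintegral nu setT f).
Hypotheses (i1 : integ (fun y : seqR => y 0%N))
  (i2 : integ (fun y : seqR => y 0%N ^+ 2)).
Hypothesis (EY0 : E (fun y : seqR => y 0%N) = 0).
Hypothesis negpart : E (fun y : seqR => y 0%N * \1_(stay nonpos 1) y) < 0.

Lemma drift0_nonpos : 0 < drift0 nu nonpos 1.
Proof. by rewrite /drift0 mulN1r oppr_gt0. Qed.

Lemma drift0_positive : 0 < drift0 nu positive (- 1).
Proof.
rewrite /drift0 opprK mul1r.
have mp := measurable_stay positive 1 measurable_positive.
have mn := measurable_stay nonpos 1 measurable_nonpos.
have : E (fun y : seqR => y 0%N * \1_(stay positive 1) y) +
       E (fun y : seqR => y 0%N * \1_(stay nonpos 1) y) = 0.
  rewrite -RintegralD//; [|exact: integM_indic..].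
  rewrite -EY0; apply: eq_Rintegral => y _.
  have w1 G : stay G 1 y <-> G (y 0%N).
    rewrite staySE walkS walk0 add0r; split => [[]//|h]; split => // i; lia.
  have [y0|y0] := leP (y 0%N) 0.
    rewrite indic_notin ?indic_in ?mulr0 ?add0r ?mulr1//; first exact/w1.
    by move=> /w1; rewrite /positive /= ltNge y0.
  rewrite indic_in ?indic_notin ?mulr0 ?addr0 ?mulr1//; last exact/w1.
  by move=> /w1; rewrite /nonpos /= leNgt y0.
move: negpart; lra.
Qed.

Lemma surv_sum_ge (G : set R) (e : R) : measurable G ->
  (forall x, ~ G x -> 0 <= e * x) -> `|e| = 1 -> 0 < drift0 nu G e ->
  forall n, (0 < n)%N -> drift0 nu G e ^+ 2 / (var0 nu + 1) <=
    surv nu G n * \sum_(k < n) surv nu G k.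
Proof.
move=> mG eG e1 a0 n n0.
set a := drift0 nu G e in a0 *; set Q := \sum_(k < n) _.
have v0 := var0_ge0 nu.
have Q0 : 0 < Q.
  rewrite /Q; case: n n0 @Q => // n _; rewrite big_ord_recl surv0.
  by rewrite ltr_pwDl// sumr_ge0// => i _; exact: surv_ge0.
have K0 : 0 < (var0 nu + 1) * Q by rewrite mulr_gt0// ltr_wpDl.
pose t := a / ((var0 nu + 1) * Q).
have t0 : 0 < t by exact: divr_gt0.
have := drift0_le nu iid i1 i2 EY0 G e mG eG e1 n 0 t n0 (lexx _) t0.
rewrite -/a -/Q mul0r add0r => h.
have {}h : a <= t / 2 * ((var0 nu + 1) * Q) + (2 * t)^-1 * surv nu G n.
  apply: (le_trans h); apply: lerD.
    by rewrite ler_pM2l ?divr_gt0// ler_pM2r// lerDl.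
  rewrite ler_pM2l; last by rewrite invr_gt0 mulr_gt0.
  apply: le_Pr.
  - apply: measurableI; first exact: measurable_stay.
    exact: measurable_norm_walk_gt.
  - exact: measurable_stay.
  - by move=> y [].
rewrite ler_pdivrMr ?ltr_wpDl//.
have eqt : t * ((var0 nu + 1) * Q) = a by rewrite /t divfK// gt_eqF.
rewrite mulrAC eqt in h.
have {}h : a / 2 <= (2 * t)^-1 * surv nu G n by lra.
have t20 : 0 < 2 * t by rewrite pmulr_rgt0.
rewrite (ler_pdivlMl _ _ t20) in h.
have -> : surv nu G n * Q * (var0 nu + 1) = surv nu G n * ((var0 nu + 1) * Q) by ring.
apply: (@le_trans _ _ (2 * t * (a / 2) * ((var0 nu + 1) * Q))).
  have -> : 2 * t * (a / 2) * ((var0 nu + 1) * Q) =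
    a * (t * ((var0 nu + 1) * Q)) by field.
  by rewrite eqt.
by rewrite ler_pM2r.
Qed.

Lemma walk_surv_bounds : exists c1 C1 : R, [/\ 0 < c1, 0 < C1 & forall n, (0 < n)%N ->
    [/\ c1 / Num.sqrt n%:R <= surv nu nonpos n,
        surv nu nonpos n <= C1 / Num.sqrt n%:R &
        \sum_(k < n) surv nu nonpos k <= C1 * Num.sqrt n%:R]].
Proof.
have v0 := var0_ge0 nu.
have mp := measurable_positive; have mn := measurable_nonpos.
pose f (a : R) := a ^+ 2 / (var0 nu + 1).
have f0 a : 0 < a -> 0 < f a by move=> a0; rewrite divr_gt0 ?exprn_gt0// ltr_wpDl.
have h1 := f0 _ drift0_nonpos; have h2 := f0 _ drift0_positive.
have m1 : Num.min (f (drift0 nu nonpos 1)) (f (drift0 nu positive (-1))) <= f (drift0 nu nonpos 1).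
  by rewrite ge_min lexx.
have m2 : Num.min (f (drift0 nu nonpos 1)) (f (drift0 nu positive (-1))) <= f (drift0 nu positive (-1)).
  by rewrite ge_min lexx orbT.
apply: (@renewal_sqrt R (surv nu nonpos) (surv nu positive)
  (Num.min (f (drift0 nu nonpos 1)) (f (drift0 nu positive (-1))))).
- by rewrite lt_min h1 h2.
- by move=> n; rewrite surv_ge0; apply: Pr_le1; exact: measurable_stay.
- by move=> n; exact: surv_ge0.
- exact: surv0.
- move=> n n0; apply: (le_trans m1); apply: surv_sum_ge => //.
  + by move=> x /negP; rewrite -ltNge mul1r => /ltW.
  + by rewrite normr1.
  + exact: drift0_nonpos.
- move=> n n0; apply: (le_trans m2); apply: surv_sum_ge => //.
  + by move=> x /negP; rewrite -leNgt mulN1r oppr_ge0.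
  + by rewrite normrN normr1.
  + exact: drift0_positive.
- by move=> n /surv_sum_le[].
- by move=> n /surv_sum_le[].
Qed.

Definition deep (h : R) n : set seqR := stay nonpos n `&` [set y | walk n y <= - h].

Lemma measurable_deep h n : measurable (deep h n).
Proof.
apply: measurableI; first by apply: measurable_stay; exact: measurable_nonpos.
rewrite -[X in measurable X]setTI.
have -> : [set y | walk n y <= - h] = walk n @^-1` `]-oo, - h].
  by apply/seteqP; split => y /=; rewrite in_itv.
exact: measurable_walk.
Qed.

Lemma deep_depends h n : depends_on_first n (deep h n).
Proof.
move=> y z yz; rewrite /deep /setI /=.
by rewrite (stay_depends nonpos n y z yz) (walk_depends n y z yz).
Qed.

Lemma Pr_deep_ge : exists eps c : R, [/\ 0 < eps, 0 < c & forall n, (0 < n)%N ->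
  c / Num.sqrt n%:R <= Pr (deep (eps * Num.sqrt n%:R) n)].
Proof.
have [c1 [C1 [c10 C10 B]]] := walk_surv_bounds.
have v0 := var0_ge0 nu; have a0 := drift0_nonpos.
set a := drift0 nu nonpos 1 in a0.
pose eps := a / (4 * C1); pose tau := a / (2 * (var0 nu + 1) * C1).
have eps0 : 0 < eps by rewrite divr_gt0// mulr_gt0.
have tau0 : 0 < tau by rewrite divr_gt0// !mulr_gt0// ltr_wpDl.
exists eps, (tau * a); split => //; first exact: mulr_gt0.
move=> n n0; have [_ q1 q2] := B _ n0.
have sn : 0 < Num.sqrt n%:R :> R by rewrite sqrtr_gt0 ltr0n.
set s := Num.sqrt n%:R in sn q1 q2 *.
have mn := measurable_nonpos.
have := drift0_le nu iid i1 i2 EY0 nonpos 1 mn _ (normr1 _) n (eps * s) (tau / s) n0 _ _.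
rewrite -/a => /(_ _ _ _)H.
have {H} : a <= eps * s * surv nu nonpos n + tau / s / 2 * (var0 nu * \sum_(k < n) surv nu nonpos k) +
    (2 * (tau / s))^-1 * Pr (stay nonpos n `&` [set y | eps * s < `|walk n y|]).
  apply: H; last exact: divr_gt0.
    by move=> x /negP; rewrite -ltNge mul1r => /ltW.
  by rewrite ltW// mulr_gt0.
have t1 : eps * s * surv nu nonpos n <= a / 4.
  apply: (@le_trans _ _ (eps * s * (C1 / s))).
    by rewrite ler_pM2l// mulr_gt0.
  by rewrite /eps le_eqVlt; apply/orP; left; apply/eqP; field; rewrite !gt_eqF.
have t2 : tau / s / 2 * (var0 nu * \sum_(k < n) surv nu nonpos k) <= a / 4.
  apply: (@le_trans _ _ (tau / s / 2 * ((var0 nu + 1) * (C1 * s)))).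
    have h1 : 0 <= tau / s / 2.
      by apply: divr_ge0 => //; exact: (divr_ge0 (ltW tau0) (ltW sn)).
    apply: (ler_wpM2l h1); apply: ler_pM => //.
      by apply: sumr_ge0 => i _; exact: surv_ge0.
    by rewrite lerDl.
  rewrite /tau le_eqVlt; apply/orP; left; apply/eqP; field.
  by rewrite !gt_eqF// ltr_wpDl.
have t3 : Pr (stay nonpos n `&` [set y | eps * s < `|walk n y|]) <= Pr (deep (eps * s) n).
  apply: le_Pr.
  - apply: measurableI; first exact: measurable_stay.
    exact: measurable_norm_walk_gt.
  - exact: measurable_deep.
  - move=> y [h1 /= h2]; split => //=; rewrite lerNr ltW//.
    have := h1 n; rewrite leqnn n0 => /(_ isT) h3.
    by rewrite -(ler0_norm h3).
move=> h; have {}h : a / 2 <= (2 * (tau / s))^-1 * Pr (deep (eps * s) n).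
  have : (2 * (tau / s))^-1 * Pr (stay nonpos n `&` [set y | eps * s < `|walk n y|]) <=
         (2 * (tau / s))^-1 * Pr (deep (eps * s) n).
    by rewrite ler_pM2l// invr_gt0 pmulr_rgt0// divr_gt0.
  lra.
have ts0 : 0 < 2 * (tau / s) by rewrite pmulr_rgt0// divr_gt0.
rewrite (ler_pdivlMl _ _ ts0) in h.
apply: le_trans h; rewrite le_eqVlt; apply/orP; left; apply/eqP; field.
by rewrite gt_eqF.
Qed.

End walk_survival.

(** * Tails of the innovations *)

Lemma exprn_le_expR_powR {R : realType} (alpha : R) (k : nat) : 0 < alpha ->
  exists2 C : R, 0 < C & forall x : R, `|x| ^+ k <= C * expR (`|x| `^ alpha).
Proof.
move=> a0; pose j := (Num.truncn (k%:R / alpha)).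
have kj : k%:R <= alpha * j.+1%:R.
  by rewrite mulrC -ler_pdivrMr// ltW// truncnS_gt.
exists (1 + j.+1`!%:R) => [|x]; first by rewrite ltr_wpDr.
have e1 : 1 <= expR (`|x| `^ alpha) by apply: le_trans (expR_ge1Dx _); rewrite lerDl powR_ge0.
have f0 : 0 <= j.+1`!%:R :> R by [].
have [x1|x1] := leP `|x| 1.
  apply: (@le_trans _ _ 1); first by rewrite exprn_ile1.
  by rewrite -[leLHS]mulr1; apply: ler_pM => //; rewrite lerDl.
apply: (@le_trans _ _ (j.+1`!%:R * expR (`|x| `^ alpha))); last first.
  by rewrite ler_pM2r ?expR_gt0// lerDr.
rewrite -powR_mulrn//; apply: (le_trans (ler_powR (ltW x1) kj)).
rewrite powRrM powR_mulrn ?powR_ge0// mulrC -ler_pdivrMr ?ltr0n ?fact_gt0//.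
by apply: le_trans (expR_ge1Dxn j (powR_ge0 `|x| alpha)); rewrite lerDr.
Qed.

Section one_step.
Context {R : realType} (nu : probability (@seqR R) R).
Hypothesis iid : iid_law nu.
Local Notation seqR := (@seqR R).
Local Notation Pr := (Pr nu).
Local Notation integ f := (nu.-integrable setT (EFin \o f)).
Local Notation E f := (Rintegral nu setT f).

Lemma measurable_coord_preimage i (B : set R) : measurable B ->
  measurable ([set y | B (y i)] : set seqR).
Proof.
by move=> mB; rewrite -[X in measurable X]setTI; exact: measurable_coord.
Qed.

Lemma Pr_box (B : set R) n : measurable B ->
  Pr [set y | forall i, i \in iota 0 n -> B (y i)] = Pr [set y | B (y 0%N)] ^+ n.
Proof.
move=> mB; apply: EFin_inj.
rewrite PrE; last exact: (@measurable_box R _ (fun=> B)).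
rewrite (iid _ (fun=> B)) ?iota_uniq// big_const_seq count_predT size_iota.
have -> : nu [set y | B (y 0%N)] = (Pr [set y | B (y 0%N)])%:E.
  by rewrite PrE//; exact: measurable_coord_preimage.
by elim: n => // n IH; rewrite iterS IH -EFinM exprS.
Qed.

Section tails.
Variable alpha : R.
Hypotheses (alpha0 : 0 < alpha)
  (expm : (\int[nu]_y (expR (`|y 0%N| `^ alpha))%:E < +oo)%E).

Lemma integ_abs_coord k : integ (fun y : seqR => `|y 0%N| ^+ k).
Proof.
have [C C0 HC] := exprn_le_expR_powR alpha k alpha0.
have mexp : measurable_fun setT (fun y : seqR => expR (`|y 0%N| `^ alpha)).
  apply: measurableT_comp => //.
  apply: (@measurableT_comp _ _ _ _ _ _ (fun x : R => x `^ alpha)) => //.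
  by apply: measurableT_comp => //; exact: measurable_coord.
have iexp : integ (fun y : seqR => C * expR (`|y 0%N| `^ alpha)).
  apply: integZ; apply/integrableP; split; first exact/measurable_EFinP.
  apply: le_lt_trans expm; rewrite le_eqVlt; apply/orP; left; apply/eqP.
  by apply: eq_integral => y _ /=; rewrite ger0_norm ?expR_ge0.
apply: (le_integrable measurableT _ _ iexp) => [|y _].
  apply/measurable_EFinP; apply: measurable_funX.
  by apply: measurableT_comp => //; exact: measurable_coord.
rewrite lee_fin /= ger0_norm ?exprn_ge0//.
exact: le_trans (HC _) (ler_norm _).
Qed.

Lemma integ_coord : integ (fun y : seqR => y 0%N).
Proof.
apply: (le_integrable measurableT _ _ (integ_abs_coord 1)) => [|y _].
  by apply/measurable_EFinP; exact: measurable_coord.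
by rewrite lee_fin /= expr1 normr_id.
Qed.

Lemma integ_coord_sqr : integ (fun y : seqR => y 0%N ^+ 2).
Proof.
have -> : (fun y : seqR => y 0%N ^+ 2) = (fun y => `|y 0%N| ^+ 2).
  by apply/funext => y; rewrite real_normK ?num_real.
exact: integ_abs_coord.
Qed.

Definition small (B : R) n : set seqR := [set y | forall i, (i < n)%N -> `|y i| <= B].

Lemma measurable_normr_le (B : R) : measurable [set x : R | `|x| <= B].
Proof.
rewrite (_ : mkset _ = (`[- B, B])%classic); first exact: measurable_itv.
by apply/seteqP; split => x /=; rewrite in_itv/= ler_norml.
Qed.

Lemma small_box B n : small B n =
  [set y | forall i, i \in iota 0 n -> [set x | `|x| <= B] (y i)].
Proof. by apply/seteqP; split => y /= h i; move: (h i); rewrite mem_iota. Qed.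

Lemma measurable_small B n : measurable (small B n).
Proof.
rewrite small_box; apply: (@measurable_box R _ (fun=> [set x | `|x| <= B])) => i.
exact: measurable_normr_le.
Qed.

Lemma Pr_small B n : Pr (small B n) = Pr (small B 1) ^+ n.
Proof. by rewrite !small_box !Pr_box ?expr1//; exact: measurable_normr_le. Qed.

Lemma Pr_not_small B n k : 0 < B ->
  Pr (~` small B n) <= n%:R * (E (fun y : seqR => `|y 0%N| ^+ k) / B ^+ k).
Proof.
move=> B0; set tau := _ / _.
have ms m := measurable_small B m.
have PC (A : set seqR) : measurable A -> Pr (~` A) = 1 - Pr A.
  move=> mA; apply: EFin_inj; rewrite PrE ?probability_setC//; last exact: measurableC.
  by rewrite EFinB PrE.
have h1 : Pr (~` small B 1) <= tau.
  rewrite /tau ler_pdivlMr ?exprn_gt0// -E_indic; last exact: measurableC.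
  have mC := measurableC (ms 1%N).
  rewrite -RintegralZr//; last exact: integ_indic.
  apply: le_Rintegral => //.
  - have := integZ nu (B ^+ k) _ (integ_indic nu _ mC).
    by congr (_.-integrable _ _); apply/funext => y /=; rewrite mulrC.
  - exact: integ_abs_coord.
  move=> y _; case: (pselect (small B 1 y)) => h.
    by rewrite ?indicE memNset ?mul0r ?exprn_ge0//; apply.
  rewrite ?indicE mem_set// mul1r; apply: lerXn2r; rewrite ?nnegrE ?(ltW B0)//.
  rewrite leNgt; apply/negP => yB; apply: h => -[|//] _; exact: ltW.
rewrite PC// in h1; rewrite PC// Pr_small.
set p := Pr (small B 1) in h1 *.
have p0 : 0 <= p by exact: Pr_ge0.
have p1 : p <= 1 by exact: Pr_le1.
apply: (@le_trans _ _ (n%:R * (1 - p))); last by rewrite ler_wpM2l.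
elim: n {ms} => [|n IH]; first by rewrite expr0 subrr mul0r.
rewrite exprS -natr1 mulrDl mul1r.
have : p * (1 - p ^+ n) <= 1 - p ^+ n.
  by rewrite ler_piMl// subr_ge0 exprn_ile1.
lra.
Qed.

End tails.

Section lower_tail.
Hypothesis (i1 : integ (fun y : seqR => y 0%N)).
Hypothesis (EY0 : E (fun y : seqR => y 0%N) = 0).
Hypothesis nondeg : nu [set y : seqR | y 0%N = 0] <> 1%E.

Definition window (k : nat) : set R := [set x | - k.+1%:R <= x <= - k.+1%:R^-1].

Lemma measurable_window k : measurable (window k).
Proof.
rewrite (_ : window k = (`[- k.+1%:R, - k.+1%:R^-1])%classic); first exact: measurable_itv.
by apply/seteqP; split => x /=; rewrite in_itv.
Qed.

Lemma Pr_window_gt0 : exists k, 0 < Pr [set y | window k (y 0%N)].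
Proof.
apply: contrapT => /forallNP h.
have mw k := measurable_coord_preimage 0 _ (measurable_window k).
have wk k : nu [set y | window k (y 0%N)] = 0%E.
  rewrite -PrE//; congr (_%:E); apply/eqP; rewrite eq_le Pr_ge0 andbT leNgt.
  exact/negP/h.
have neg0 : nu [set y : seqR | y 0%N < 0] = 0%E.
  have -> : [set y : seqR | y 0%N < 0] = \bigcup_k [set y | window k (y 0%N)].
    apply/seteqP; split => y /=; last first.
      by move=> [k _ /= /andP[_ h2]]; apply: (le_lt_trans h2); rewrite oppr_lt0 invr_gt0.
    move=> y0; pose c := Num.max (- y 0%N) (- (y 0%N)^-1).
    have c1 : c < (Num.truncn c).+1%:R by exact: truncnS_gt.
    exists (Num.truncn c) => //=; move: c1; rewrite /c gt_max => /andP[c1 c2].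
    apply/andP; split; first by rewrite lerNl ltW.
    rewrite lerNr -[leRHS]invrK lef_pV2 ?posrE//; last first.
      by rewrite invr_gt0 oppr_gt0.
    by rewrite invrN ltW.
  apply: measure_negligible; first exact: bigcupT_measurable.
  apply: negligible_bigcup => k.
  by apply/(negligibleP _ (mw k)); exact: wk.
apply: nondeg.
have ae0 : ae_eq nu setT (fun y : seqR => `|(y 0%N)%:E|%E) (fun y => (y 0%N)%:E).
  exists [set y : seqR | y 0%N < 0]; split => //.
    by apply: (measurable_coord_preimage 0 [set x | x < 0]); rewrite -set_itvNyo.
  move=> y /= /not_implyP[_]; apply: contraPT; rewrite -leNgt => y0.
  by apply/contrapT; apply; rewrite /= ger0_norm.
have mc : measurable_fun setT (fun y : seqR => (y 0%N)%:E).
  by apply/measurable_EFinP; exact: measurable_coord.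
have : (\int[nu]_y `|(y 0%N)%:E| = 0)%E.
  have mac : measurable_fun setT (fun y : seqR => `|(y 0%N)%:E|%E).
    exact: measurableT_comp.
  rewrite (ae_eq_integral (fun y : seqR => (y 0%N)%:E) _ measurableT mac mc ae0).
  by rewrite -(fineK (integrable_fin_num measurableT i1)) -[fine _]/(E (fun y : seqR => y 0%N)) EY0.
move/(ae_eq_integral_abs nu measurableT mc) => [N [mN N0 sub]].
have m0 : measurable ([set y | y 0%N = 0] : set seqR).
  exact: (measurable_coord_preimage 0 [set 0]).
apply/eqP; rewrite eq_le probability_le1//= -(sube0 1%E) -N0 -probability_setC//.
apply: le_measure; rewrite ?inE//; first exact: measurableC.
move=> y Ny; apply: contrapT => y0; apply: Ny; apply: sub => /= /(_ I) [].
exact: y0.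
Qed.

Lemma negative_part_lt0 : E (fun y : seqR => y 0%N * \1_(stay nonpos 1) y) < 0.
Proof.
have [k pk] := Pr_window_gt0.
have mw := measurable_coord_preimage 0 _ (measurable_window k).
have mn := measurable_stay nonpos 1 measurable_nonpos.
apply: (@le_lt_trans _ _ (- k.+1%:R^-1 * Pr [set y | window k (y 0%N)])); last first.
  by rewrite mulNr oppr_lt0 mulr_gt0// invr_gt0.
rewrite -E_indic// -RintegralZl//; last exact: integ_indic.
apply: le_Rintegral => //.
- exact: integM_indic.
- by apply: integZ; exact: integ_indic.
move=> y _.
have w1 : stay nonpos 1 y <-> y 0%N <= 0.
  rewrite staySE walkS walk0 add0r; split => [[]//|h]; split => // i; lia.
case: (pselect ([set y : seqR | window k (y 0%N)] y)) => h.
  rewrite !indicE (mem_set h) mulr1; move/andP : h => [_ h].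
  rewrite mem_set ?mulr1//; apply/w1; apply: (le_trans h).
  by rewrite oppr_le0 invr_ge0.
rewrite !indicE (memNset h) mulr0.
have [y0|y0] := leP (y 0%N) 0; first by rewrite mem_set ?mulr1//; exact/w1.
by rewrite memNset ?mulr0// => /w1; rewrite leNgt y0.
Qed.

End lower_tail.
End one_step.

Section transfer.
Context {d} {T : measurableType d} {R : realType} {P : probability T R}
  (Y : nat -> {RV P >-> R}).

Definition path_of (w : T) : @seqR R := fun k => Y k w.

Lemma measurable_path_of : measurable_fun setT path_of.
Proof. by apply: measurable_to_seqR => k; exact: measurable_funPT. Qed.

HB.instance Definition _ :=
  isMeasurableFun.Build _ _ _ _ path_of measurable_path_of.

Definition path_law : probability (@seqR R) R := distribution P path_of.

Lemma path_law_iid : iid_seq Y -> iid_law path_law.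
Proof.
move=> [ind idd] s B us mB; rewrite /path_law /distribution /pushforward /=.
transitivity (P (\bigcap_(i in [set` s]) (Y i @^-1` B i))).
  by congr (P _); apply/seteqP; split.
rewrite ind//; apply: eq_bigr => i _; exact: idd.
Qed.

End transfer.

(** * The AR(2) process *)

Definition ar2_stay {R : realType} (a1 a2 : R) N : set (@seqR R) :=
  [set y | forall n, (1 <= n <= N)%N -> ar2 a1 a2 y n <= 0].

Section alternating.
Context {R : realType}.
Local Notation seqR := (@seqR R).

Lemma ar2_pair_alternating (y : seqR) k :
  ar2_pair 0 1 y k.*2 = (walk k ((fun j => y j.*2.+1) : seqR), walk k ((fun j => y j.*2) : seqR)).
Proof.
elim: k => [|k IH]; first by rewrite !walk0.
rewrite doubleS /= IH /= !walkS; congr pair; ring.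
Qed.

Lemma ar2_even (y : seqR) k : ar2 0 1 y k.*2 = walk k ((fun j => y j.*2.+1) : seqR).
Proof. by rewrite /ar2 ar2_pair_alternating. Qed.

Lemma ar2_odd (y : seqR) k : ar2 0 1 y k.*2.+1 = walk k.+1 ((fun j => y j.*2) : seqR).
Proof.
by rewrite /ar2 /= ar2_pair_alternating /= mul0r mul1r add0r walkS.
Qed.

Lemma ar2_stay_alternating N : ar2_stay (0 : R) 1 N =
  [set y | stay nonpos (uphalf N) ((fun k => y k.*2) : seqR) /\
           stay nonpos (N./2) ((fun k => y k.*2.+1) : seqR)].
Proof.
apply/seteqP; split => y /=.
  move=> h; split => i iN; rewrite /nonpos /=.
    have {1}-> : i = i.-1.+1 by lia.
    by rewrite -ar2_odd; apply: h; lia.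
  by rewrite -ar2_even; apply: h; lia.
move=> [h1 h2] n nN; have [on|en] := boolP (odd n).
  have -> : n = n./2.*2.+1 by lia.
  by rewrite ar2_odd; apply: h1; lia.
have -> : n = n./2.*2 by lia.
by rewrite ar2_even; apply: h2; lia.
Qed.

Lemma alternating_survival (nu : probability seqR R) : iid_law nu ->
  (exists c1 C1 : R, [/\ 0 < c1, 0 < C1 & forall n, (0 < n)%N ->
    [/\ c1 / Num.sqrt n%:R <= surv nu nonpos n,
        surv nu nonpos n <= C1 / Num.sqrt n%:R &
        \sum_(k < n) surv nu nonpos k <= C1 * Num.sqrt n%:R]]) ->
  exists c C : R, 0 < c /\ 0 < C /\
    forall N, (1 < N)%N -> c / N%:R <= Pr nu (ar2_stay 0 1 N) <= C / N%:R.
Proof.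
move=> iid [c1 [C1 [c0 C0 B]]]; have mn := @measurable_nonpos R.
exists (c1 ^+ 2), (4 * C1 ^+ 2); split; first exact: exprn_gt0.
split; first by rewrite mulr_gt0// exprn_gt0.
move=> N N1; rewrite ar2_stay_alternating.
rewrite (Pr_interleave nu iid (stay nonpos (uphalf N)) (stay nonpos N./2));
  [|exact: measurable_stay..].
rewrite -/(surv nu nonpos _) -/(surv nu nonpos _).
have u0 : (0 < uphalf N)%N by lia.
have h0 : (0 < N./2)%N by lia.
have [lu hu _] := B _ u0; have [lh hh _] := B _ h0.
have su : 0 < Num.sqrt (uphalf N)%:R :> R by rewrite sqrtr_gt0 ltr0n.
have sh : 0 < Num.sqrt (N./2)%:R :> R by rewrite sqrtr_gt0 ltr0n.
have N0 : 0 < N%:R :> R by rewrite ltr0n; lia.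
have sN : Num.sqrt (uphalf N)%:R * Num.sqrt (N./2)%:R = Num.sqrt (uphalf N * N./2)%:R :> R.
  by rewrite natrM sqrtrM.
have NE : N%:R = Num.sqrt (N * N)%:R :> R by rewrite natrM -expr2 sqrtr_sqr ger0_norm.
apply/andP; split.
  apply: (@le_trans _ _ (c1 / Num.sqrt (uphalf N)%:R * (c1 / Num.sqrt (N./2)%:R))).
    rewrite mulrACA -invfM sN expr2 ler_pM2l ?mulr_gt0//.
    rewrite lef_pV2 ?posrE//; last by rewrite -sN mulr_gt0.
    rewrite NE; apply: ler_wsqrtr; rewrite ler_nat; apply: leq_mul; lia.
  by apply: ler_pM => //; rewrite divr_ge0// ltW.
apply: (@le_trans _ _ (C1 / Num.sqrt (uphalf N)%:R * (C1 / Num.sqrt (N./2)%:R))).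
  by apply: ler_pM => //; exact: surv_ge0.
rewrite mulrACA -invfM sN -expr2 [leRHS]mulrAC [leRHS]mulrC.
rewrite ler_pM2l ?exprn_gt0//.
rewrite ler_pdivlMr// ler_pdivrMl; last by rewrite -sN mulr_gt0.
rewrite NE (_ : 4 = Num.sqrt (4 * 4)%:R); last first.
  by rewrite natrM -expr2 sqrtr_sqr ger0_norm.
rewrite -sqrtrM// -natrM; apply: ler_wsqrtr; rewrite ler_nat.
have h3 : (N <= 3 * N./2)%N by lia.
have h4 : (N <= 2 * uphalf N)%N by lia.
have := leq_mul h4 h3; nia.
Qed.

End alternating.

Lemma exists_nat_root (p N : nat) : (0 < p)%N ->
  exists m, (m ^ p <= N < m.+1 ^ p)%N.
Proof.
move=> p0; elim: N => [|N [m /andP[mN Nm]]].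
  by exists 0%N; rewrite exp0n// exp1n.
have [h|h] := ltnP N.+1 (m.+1 ^ p); first by exists m; rewrite h leqW.
exists m.+1; rewrite h /=.
by apply: leq_ltn_trans (_ : m.+1 ^ p < _)%N; rewrite ?ltn_exp2r.
Qed.

Lemma sqrtr_nat_le4 {R : realType} (a b : nat) : (a <= 4 * b)%N ->
  Num.sqrt a%:R <= 2 * Num.sqrt b%:R :> R.
Proof.
move=> ab; have -> : 2 = Num.sqrt (4%:R) :> R.
  by rewrite (_ : 4 = 2 ^+ 2) ?sqrtr_sqr ?ger0_norm// -natrX.
by rewrite -sqrtrM// -natrM; apply: ler_wsqrtr; rewrite ler_nat.
Qed.

Section ar2_path.
Context {R : realType}.
Local Notation seqR := (@seqR R).
Variable rho : R.
Hypothesis rho1 : `|rho| < 1.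

Local Notation AR n y := (ar2 (1 + rho) (- rho) y n).

Definition incr n (y : seqR) : R :=
  (ar2_pair (1 + rho) (- rho) y n).1 - (ar2_pair (1 + rho) (- rho) y n).2.

Lemma incr0 y : incr 0 y = 0. Proof. by rewrite /incr subrr. Qed.

Lemma incrS n y : incr n.+1 y = rho * incr n y + y n.
Proof. by rewrite /incr /=; ring. Qed.

Lemma ar2S n y : AR n.+1 y = AR n y + incr n.+1 y.
Proof. by rewrite /incr /ar2 /=; ring. Qed.

Lemma ar2_walk n y : (1 - rho) * AR n y = walk n y - rho * incr n y.
Proof.
elim: n => [|n IH]; first by rewrite walk0 incr0 /ar2 /= !mulr0 subr0.
by rewrite ar2S mulrDr IH walkS incrS; ring.
Qed.

Lemma ar2_pair_depends n : depends_on_first n (ar2_pair (1 + rho) (- rho) ^~ n).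
Proof.
elim: n => // n IH y z yz /=.
by rewrite (IH y z) ?yz// => i ni; apply: yz; exact: leqW.
Qed.

Lemma incr_depends n : depends_on_first n (incr n).
Proof. by move=> y z yz; rewrite /incr (ar2_pair_depends n y z). Qed.

Lemma ar2_depends n : depends_on_first n (fun y : seqR => AR n y).
Proof. by move=> y z yz; rewrite /ar2 (ar2_pair_depends n y z). Qed.

Lemma measurable_incr n : measurable_fun setT (incr n).
Proof.
elim: n => [|n IH].
  by rewrite (_ : incr 0 = cst 0)//; apply/funext => y; rewrite incr0.
rewrite (_ : incr n.+1 = (fun y => rho * incr n y + y n)); last first.
  by apply/funext => y; rewrite incrS.
by apply: measurable_funD; [exact: measurable_funM|exact: measurable_coord].
Qed.

Lemma measurable_ar2 n : measurable_fun setT (fun y : seqR => AR n y).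
Proof.
elim: n => [|n IH]; first by [].
rewrite (_ : (fun y : seqR => _) = (fun y => AR n y + incr n.+1 y)); last first.
  by apply/funext => y; rewrite ar2S.
by apply: measurable_funD => //; exact: measurable_incr.
Qed.

Lemma measurable_ar2_stay N : measurable (ar2_stay (1 + rho) (- rho) N : set seqR).
Proof.
have -> : ar2_stay (1 + rho) (- rho) N =
  \bigcap_(i in [set i | (1 <= i <= N)%N]) ((fun y : seqR => AR i y) @^-1` nonpos).
  by apply/seteqP; split.
apply: bigcap_measurableType => i _.
rewrite -[X in measurable X]setTI; apply: measurable_ar2 => //.
exact: measurable_nonpos.
Qed.

Lemma ar2_stay_depends N : depends_on_first N (ar2_stay (1 + rho) (- rho) N : set seqR).
Proof.
move=> y z yz; apply/propext; split => h i /[dup] /andP[_ i2] /h;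
  by rewrite (ar2_depends i y z)// => j ji; apply: yz; exact: leq_trans i2.
Qed.

Lemma incr_bound m n (B : R) (y : seqR) : 0 <= B ->
  (forall i, (i < n)%N -> `|y (m + i)%N| <= B) ->
  `|incr (m + n) y| <= `|incr m y| + B / (1 - `|rho|).
Proof.
move=> B0; have r1 : 0 < 1 - `|rho| by rewrite subr_gt0.
elim: n => [|n IH] h; first by rewrite addn0 lerDl divr_ge0// ltW.
rewrite addnS incrS; apply: (le_trans (ler_normD _ _)); rewrite normrM.
have {}IH := IH (fun i ni => h i (leqW ni)); have hn := h n (ltnSn n).
have r0 : 0 <= `|rho| by [].
have h1 : `|rho| * `|incr (m + n) y| <= `|rho| * `|incr m y| + `|rho| * (B / (1 - `|rho|)).
  by rewrite -mulrDr ler_wpM2l.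
have h2 : `|rho| * `|incr m y| <= `|incr m y| by rewrite ler_piMl// ltW.
have h3 : `|rho| * (B / (1 - `|rho|)) + B = B / (1 - `|rho|).
  by field; rewrite gt_eqF.
lra.
Qed.

Lemma ar2_stay_nonpos_innovations n (y : seqR) :
  (forall i, (i < n)%N -> y i <= 0) -> ar2_stay (1 + rho) (- rho) n y.
Proof.
move=> yn.
suff H m : (m <= n)%N -> AR m y <= 0 /\ AR m y + rho * incr m y <= 0 /\
    (0 <= rho -> incr m y <= 0).
  by move=> i /andP[_ /H[]].
elim: m => [|m IH] mn; first by rewrite incr0 mulr0 addr0 /ar2.
have [h1 [h2 h3]] := IH (ltnW mn); have ym := yn m mn.
have : - 1 < rho < 1 by rewrite -ltr_norml.
move=> /andP[r_1 r_2].
have x1 : AR m.+1 y <= 0 by rewrite ar2S incrS; lra.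
split => //; have [r0|r0] := leP 0 rho.
  have {}h3 := h3 r0.
  have i1 : incr m.+1 y <= 0.
    by rewrite incrS; have := mulr_ge0_le0 r0 h3; lra.
  by have := mulr_ge0_le0 r0 i1; split => //; lra.
split; last by move=> ?; lra.
rewrite ar2S incrS.
have -> : AR m y + (rho * incr m y + y m) + rho * (rho * incr m y + y m) =
  - rho * AR m y + (1 + rho) * (AR m y + rho * incr m y) + (1 + rho) * y m by ring.
have e1 : - rho * AR m y <= 0 by rewrite mulr_ge0_le0// oppr_ge0 ltW.
have e2 : (1 + rho) * (AR m y + rho * incr m y) <= 0 by rewrite mulr_ge0_le0//; lra.
have e3 : (1 + rho) * y m <= 0 by rewrite mulr_ge0_le0//; lra.
lra.
Qed.
End ar2_path.

Section polynomial_bounds.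
Context {R : realType} (nu : probability (@seqR R) R).
Hypothesis iid : iid_law nu.
Local Notation seqR := (@seqR R).
Local Notation Pr := (Pr nu).
Local Notation E f := (Rintegral nu setT f).
Variable alpha : R.
Hypotheses (alpha0 : 0 < alpha)
  (expm : (\int[nu]_y (expR (`|y 0%N| `^ alpha))%:E < +oo)%E).
Hypothesis (EY0 : E (fun y : seqR => y 0%N) = 0).
Hypothesis nondeg : nu [set y : seqR | y 0%N = 0] <> 1%E.
Variable rho : R.
Hypothesis rho1 : `|rho| < 1.
Local Notation ar2_stay N := (ar2_stay (1 + rho) (- rho) N).

Local Notation i1 := (integ_coord nu alpha alpha0 expm).
Local Notation i2 := (integ_coord_sqr nu alpha alpha0 expm).
Local Notation neg := (negative_part_lt0 nu i1 EY0 nondeg).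
Local Notation surv_bounds := (walk_surv_bounds nu iid i1 i2 EY0 neg).
Local Notation deep_ge := (Pr_deep_ge nu iid i1 i2 EY0 neg).

Definition below (L : R) : set R := [set x | x <= L].

Lemma measurable_below L : measurable (below L).
Proof.
rewrite (_ : below L = `]-oo, L]%classic); first exact: measurable_itv.
by apply/seteqP; split => x; rewrite /below /= in_itv.
Qed.

Lemma stay_below_le : exists2 C : R, 0 < C & forall L N, 0 <= L -> (0 < N)%N ->
  Pr (stay (below L) N) <= C * (L + 1) / Num.sqrt N%:R.
Proof.
have [c1 [C1 [c10 C10 B]]] := surv_bounds.
have [eps [c [eps0 c0 D]]] := deep_ge.
exists (C1 / c * (eps^-1 + 1)) => [|L N L0 N0].
  by rewrite mulr_gt0 ?divr_gt0// addr_gt0// invr_gt0.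
pose u := L / eps; have u0 : 0 <= u by rewrite divr_ge0// ltW.
have [M [M0 Mlo Mhi]] : exists M, [/\ (0 < M)%N, u <= Num.sqrt M%:R &
    Num.sqrt M%:R <= u + 1].
  exists (Num.truncn (u ^+ 2)).+1; split => //.
    rewrite -[leLHS]ger0_norm// -sqrtr_sqr; apply: ler_wsqrtr.
    by rewrite ltW// truncnS_gt.
  have h : 0 <= u + 1 by rewrite addr_ge0.
  rewrite -[leRHS]ger0_norm// -sqrtr_sqr; apply: ler_wsqrtr.
  rewrite -natr1 sqrrD1.
  have : (Num.truncn (u ^+ 2))%:R <= u ^+ 2 by rewrite truncn_le// sqr_ge0.
  lra.
have mb := measurable_stay _ N (measurable_below L).
have mn := @measurable_nonpos R.
have key : Pr (deep (eps * Num.sqrt M%:R) M) * Pr (stay (below L) N) <=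
    surv nu nonpos N.
  rewrite -(Pr_drop_first_indep nu iid M)//; last first.
  - exact: deep_depends.
  - exact: measurable_deep.
  apply: (@le_trans _ _ (surv nu nonpos (M + N))); last first.
    by apply: surv_le => //; exact: leq_addl.
  apply: le_Pr.
  - apply: measurableI; first exact: measurable_deep.
    by rewrite -[X in measurable X]setTI; exact: measurable_drop_first.
  - exact: measurable_stay.
  move=> y [[h1 /= h2] h3] i /andP[i0 iMN].
  have [iM|Mi] := leqP i M; first by apply: h1; rewrite i0.
  rewrite /nonpos /= -(subnKC (ltnW Mi)) walkD.
  have iMN' : (1 <= i - M <= N)%N by rewrite subn_gt0 Mi leq_subLR.
  have : walk (i - M) (drop_first M y) <= L by exact: h3.
  have : L <= eps * Num.sqrt M%:R by rewrite mulrC -ler_pdivrMr.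
  lra.
have sM : 0 < Num.sqrt M%:R :> R by rewrite sqrtr_gt0 ltr0n.
have sN : 0 < Num.sqrt N%:R :> R by rewrite sqrtr_gt0 ltr0n.
have [_ qN _] := B _ N0.
have k2 : c / Num.sqrt M%:R * Pr (stay (below L) N) <= C1 / Num.sqrt N%:R.
  apply: le_trans qN; apply: le_trans key.
  by apply: ler_wpM2r; [exact: Pr_ge0|exact: D].
rewrite -ler_pdivlMl ?divr_gt0// invf_div in k2.
apply: (le_trans k2).
have -> : Num.sqrt M%:R / c * (C1 / Num.sqrt N%:R) =
    C1 / c * Num.sqrt M%:R / Num.sqrt N%:R by field; rewrite !gt_eqF.
apply: ler_wpM2r; first by rewrite invr_ge0 ltW.
rewrite -[leRHS]mulrA; apply: ler_wpM2l; first by rewrite divr_ge0// ltW.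
apply: (le_trans Mhi).
have e1 : 0 < eps^-1 by rewrite invr_gt0.
rewrite /u mulrDl mulrDr; have := ltW e1; nra.
Qed.

Lemma ar2_surv_upper (k : nat) : (0 < k)%N ->
  exists2 C : R, 0 < C & forall N, (0 < N)%N ->
    Pr (ar2_stay N) <= C * N%:R `^ k%:R^-1 / Num.sqrt N%:R.
Proof.
move=> k0; have [C C0 HC] := stay_below_le.
have r1 : 0 < 1 - `|rho| by rewrite subr_gt0.
pose m2k := E (fun y : seqR => `|y 0%N| ^+ (2 * k)).
have m0 : 0 <= m2k by apply: Rintegral_ge0 => y _; exact: exprn_ge0.
have ir1 : 0 < (1 - `|rho|)^-1 by rewrite invr_gt0.
exists (C * ((1 - `|rho|)^-1 + 1) + m2k) => [|N N0].
  by rewrite ltr_wpDr// mulr_gt0// addr_gt0.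
set B := N%:R `^ k%:R^-1.
have N1 : 1 <= N%:R :> R by rewrite ler1n.
have B1 : 1 <= B.
  by rewrite /B -[leLHS](@powRr0 R N%:R); apply: ler_powR.
have B0 : 0 < B by exact: lt_le_trans B1.
have Bk : B ^+ (2 * k) = N%:R ^+ 2.
  rewrite mulnC exprM -[B ^+ k]powR_mulrn ?(ltW B0)// -powRrM.
  by rewrite mulVf ?pnatr_eq0 -?lt0n// powRr1.
have sN : 0 < Num.sqrt N%:R :> R by rewrite sqrtr_gt0 ltr0n.
have sN1 : Num.sqrt N%:R <= N%:R :> R.
  rewrite -[leRHS]ger0_norm// -sqrtr_sqr; apply: ler_wsqrtr.
  by rewrite expr2 ler_peMr.
pose L := B / (1 - `|rho|).
have L0 : 0 <= L by rewrite divr_ge0// ltW.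
have mb := measurable_stay _ N (measurable_below L).
have ms := measurable_small B N.
have msub : Pr (ar2_stay N) <= Pr (stay (below L) N) + Pr (~` small B N).
  rewrite -lee_fin EFinD !PrE//; [|exact: measurableC|exact: measurable_ar2_stay].
  apply: (le_trans _ (measureU2 _ mb (measurableC ms))).
  apply: le_measure; rewrite ?inE//.
  - exact: measurable_ar2_stay.
  - by apply: measurableU => //; exact: measurableC.
  move=> y hy; case: (pselect (small B N y)) => hs; last by right.
  left => i /[dup] iN /hy hx; rewrite /below /=.
  have := ar2_walk rho i y.
  have r2 : 0 <= 1 - rho by have := ler_norm rho; lra.
  have h1 := mulr_ge0_le0 r2 hx.
  have h2 : `|incr rho (0 + i) y| <= `|incr rho 0 y| + L.
    apply: incr_bound => //; first exact: ltW.
    by move=> j ji; apply: hs; case/andP: iN => _; exact: leq_trans.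
  rewrite incr0 normr0 !add0r in h2.
  have h3 : rho * incr rho i y <= L.
    apply: (le_trans (ler_norm _)); rewrite normrM.
    by rewrite -[leRHS]mul1r; apply: ler_pM => //; exact: ltW.
  lra.
apply: (le_trans msub).
have ns := Pr_not_small nu iid alpha alpha0 expm B N (2 * k) B0.
rewrite -/m2k Bk in ns.
have t1 : N%:R * (m2k / N%:R ^+ 2) <= m2k * B / Num.sqrt N%:R.
  have -> : N%:R * (m2k / N%:R ^+ 2) = m2k / N%:R.
    by field; rewrite pnatr_eq0 -lt0n.
  apply: ler_pM => //; rewrite ?invr_ge0//; first by rewrite ler_peMr.
  by rewrite lef_pV2 ?posrE ?ltr0n.
have t2 : C * (L + 1) / Num.sqrt N%:R <= C * ((1 - `|rho|)^-1 + 1) * B / Num.sqrt N%:R.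
  apply: ler_wpM2r; first by rewrite invr_ge0 ltW.
  rewrite -mulrA; apply: ler_wpM2l; first exact: ltW.
  by rewrite /L mulrDl mul1r mulrC lerD2l.
have := HC L N L0 N0; rewrite !mulrDl in t1 t2 *; lra.
Qed.

(* The depth [2 kappa sqrt m] absorbs later increments of size up to
   [2 kappa sqrt m]: the one inherited at time [m], and those produced by
   innovations of size at most [(1 - |rho|) kappa sqrt m]. *)
Definition good (kappa : R) m : set seqR := ar2_stay m `&`
  [set y | walk m y <= - (2 * kappa * Num.sqrt m%:R)] `&`
  [set y | `|incr rho m y| <= kappa * Num.sqrt m%:R].

Lemma measurable_good kappa m : measurable (good kappa m).
Proof.
apply: measurableI; first apply: measurableI.
- exact: measurable_ar2_stay.
- rewrite -[X in measurable X]setTI.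
  exact: (measurable_walk m measurableT (below _) (measurable_below _)).
- rewrite -[X in measurable X]setTI.
  exact: (measurable_incr rho m measurableT [set x | `|x| <= _] (measurable_normr_le _)).
Qed.

Lemma good_depends kappa m : depends_on_first m (good kappa m).
Proof.
move=> y z yz; rewrite /good /setI /=.
by rewrite (ar2_stay_depends rho m y z yz) (walk_depends m y z yz)
  (incr_depends rho m y z yz).
Qed.

Lemma good_extend kappa eps m M (B := (1 - `|rho|) * kappa * Num.sqrt m%:R) :
  0 < kappa -> 4 * kappa <= eps -> (3 * m <= M)%N ->
  good kappa m `&` drop_first m @^-1`
    (deep (eps * Num.sqrt M%:R) M `&` small B M) `<=` good kappa (m + M).
Proof.
move=> k0 keps mM y [[[hx hw] hd] [[hs hM] hB]].
have r1 : 0 < 1 - `|rho| by rewrite subr_gt0.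
rewrite /= in hw hd hM.
have sm : 0 <= Num.sqrt m%:R :> R by exact: sqrtr_ge0.
have sM : 0 <= Num.sqrt M%:R :> R by exact: sqrtr_ge0.
have B0 : 0 <= B by rewrite !mulr_ge0// ltW.
have BE : B / (1 - `|rho|) = kappa * Num.sqrt m%:R.
  by rewrite /B; field; rewrite gt_eqF.
have di j : (j <= M)%N -> `|incr rho (m + j) y| <= 2 * kappa * Num.sqrt m%:R.
  move=> jM; have := incr_bound rho rho1 m j B y B0; rewrite BE => h.
  apply: (le_trans (h _)); last by lra.
  by move=> i ij; apply: (hB i); exact: leq_trans jM.
have ks : 0 <= 2 * kappa * Num.sqrt m%:R by rewrite !mulr_ge0// ltW.
split; first split.
- move=> i /andP[i0 iN]; have [im|mi] := leqP i m; first by apply: hx; rewrite i0.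
  have r2 : 0 < 1 - rho by have := ler_norm rho; lra.
  rewrite -(pmulr_rle0 _ r2) ar2_walk.
  have iE : (m + (i - m) = i)%N by rewrite subnKC// ltnW.
  have := di (i - m)%N; rewrite iE => /(_ _) h.
  have {}h : `|incr rho i y| <= 2 * kappa * Num.sqrt m%:R by apply: h; rewrite leq_subLR.
  have h3 : - (rho * incr rho i y) <= 2 * kappa * Num.sqrt m%:R.
    apply: (le_trans (ler_norm _)); rewrite normrN normrM.
    by rewrite -[leRHS]mul1r; apply: ler_pM => //; exact: ltW.
  have h4 : walk (i - m) (drop_first m y) <= 0.
    by apply: hs; rewrite subn_gt0 mi leq_subLR.
  by rewrite -{1}iE walkD; lra.
- rewrite /= walkD.
  have h1 : Num.sqrt (m + M)%:R <= 2 * Num.sqrt M%:R :> R by apply: sqrtr_nat_le4; clear -mM; lia.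
  have h2 : 2 * kappa * Num.sqrt (m + M)%:R <= eps * Num.sqrt M%:R.
    apply: (@le_trans _ _ (4 * kappa * Num.sqrt M%:R)); last by rewrite ler_wpM2r.
    have := ler_wpM2l (mulr_ge0 (ler0n R 2) (ltW k0)) h1; lra.
  lra.
- rewrite /=; apply: (le_trans (di M (leqnn M))).
  have h1 : Num.sqrt (4 * m)%:R <= Num.sqrt (m + M)%:R :> R.
    by apply: ler_wsqrtr; rewrite ler_nat; clear -mM; lia.
  have h2 : Num.sqrt (4 * m)%:R = 2 * Num.sqrt m%:R :> R.
    rewrite natrM sqrtrM//; congr (_ * _).
    by rewrite (_ : 4%:R = 2 ^+ 2) ?sqrtr_sqr ?ger0_norm// -natrX.
  rewrite h2 in h1; have := ler_wpM2l (ltW k0) h1; lra.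
Qed.

Lemma Pr_good_extend (p : nat) (kappa : R) : 0 < kappa -> (1 < p)%N ->
  (exists eps c : R, [/\ 4 * kappa <= eps, 0 < c & forall n, (0 < n)%N ->
     c / Num.sqrt n%:R <= Pr (deep (eps * Num.sqrt n%:R) n)]) ->
  exists c n0, 0 < c /\ forall m N, (n0 <= m)%N -> (m ^ p <= N < m.+1 ^ p)%N ->
    c / Num.sqrt N%:R * Pr (good kappa m) <= Pr (good kappa N).
Proof.
move=> k0 p1 [eps [c [keps c0 D]]].
have r1 : 0 < 1 - `|rho| by rewrite subr_gt0.
pose b := (1 - `|rho|) * kappa; have b0 : 0 < b by exact: mulr_gt0.
pose mm := E (fun y : seqR => `|y 0%N| ^+ (2 * (2 * p))).
have mm0 : 0 <= mm by apply: Rintegral_ge0 => y _; exact: exprn_ge0.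
pose K := mm * 4 ^+ p / b ^+ (2 * (2 * p)).
have K0 : 0 <= K by rewrite divr_ge0 ?mulr_ge0 ?exprn_ge0// ltW.
pose u := 2 * K / c; have u0 : 0 <= u.
  by apply: divr_ge0; [exact: mulr_ge0|exact: ltW].
have [n1 un1] : exists n : nat, u ^+ 2 <= n%:R.
  by exists (Num.truncn (u ^+ 2)).+1; rewrite ltW// truncnS_gt.
exists (c / 2), (maxn 4 n1); split; first exact: divr_gt0.
move=> m N; rewrite geq_max => /andP[m4 mu] /andP[mN Nm].
have mN4 : (4 * m <= N)%N.
  apply: leq_trans mN; have : (m ^ 2 <= m ^ p)%N by apply: leq_pexp2l => //; exact: leq_trans m4.
  by apply: leq_trans; rewrite expnS expn1 leq_mul2r m4 orbT.
pose M := (N - m)%N; have NE : N = (m + M)%N by rewrite /M; clear -mN4; lia.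
have m0' : (0 < m)%N by exact: leq_trans m4.
have N0' : (0 < N)%N by clear -mN4 m0'; lia.
have M0 : (0 < M)%N by rewrite /M; clear -mN4 m0'; lia.
have leMN : (M <= N)%N by exact: leq_subr.
have lemN : (m <= N)%N by clear -mN4; lia.
pose B := b * Num.sqrt m%:R.
have m0 : 0 < m%:R :> R by rewrite ltr0n.
have sm : 0 < Num.sqrt m%:R :> R by rewrite sqrtr_gt0.
have N0 : 0 < N%:R :> R by rewrite ltr0n.
have sN : 0 < Num.sqrt N%:R :> R by rewrite sqrtr_gt0.
have sNE : Num.sqrt N%:R * Num.sqrt N%:R = N%:R :> R by rewrite -expr2 sqr_sqrtr// ltW.
have B0 : 0 < B by exact: mulr_gt0.
have md := measurable_deep (eps * Num.sqrt M%:R) M.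
have ms := measurable_small B M.
have hdeep := D M M0.
have hns := Pr_not_small nu iid alpha alpha0 expm B M (2 * (2 * p)) B0.
rewrite -/mm in hns.
have hB : B ^+ (2 * (2 * p)) = b ^+ (2 * (2 * p)) * m%:R ^+ (2 * p).
  by rewrite /B exprMn [Num.sqrt _ ^+ _]exprM sqr_sqrtr// ltW.
have hmN : N%:R ^+ 2 <= 4 ^+ p * m%:R ^+ (2 * p) :> R.
  rewrite -!natrX -natrM ler_nat.
  have -> : (4 ^ p * m ^ (2 * p) = ((2 * m) ^ p) ^ 2)%N.
    by rewrite !expnMn -!expnM (mulnC p) (expnM 2 2 p).
  rewrite leq_sqr; apply: ltnW; apply: (leq_trans Nm).
  by rewrite leq_exp2r; [clear -m0'; lia|exact: ltnW].
have herr : M%:R * (mm / B ^+ (2 * (2 * p))) <= K / N%:R.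
  apply: (@le_trans _ _ (N%:R * (mm / B ^+ (2 * (2 * p))))).
    apply: ler_wpM2r; first by rewrite divr_ge0// exprn_ge0// ltW.
    by rewrite ler_nat.
  rewrite hB /K.
  have bp : 0 < b ^+ (2 * (2 * p)) by exact: exprn_gt0.
  have mp : 0 < m%:R ^+ (2 * p) :> R by exact: exprn_gt0.
  rewrite ler_pdivlMr//.
  have -> : N%:R * (mm / (b ^+ (2 * (2 * p)) * m%:R ^+ (2 * p))) * N%:R =
    (mm / b ^+ (2 * (2 * p))) * (N%:R ^+ 2 / m%:R ^+ (2 * p)).
    by field; rewrite !gt_eqF.
  rewrite [leRHS]mulrAC; apply: ler_wpM2l; first by rewrite divr_ge0// ltW.
  by rewrite ler_pdivrMr.
have hK : K / N%:R <= c / 2 / Num.sqrt N%:R.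
  have us : u <= Num.sqrt N%:R.
    rewrite -[leLHS]ger0_norm// -sqrtr_sqr; apply: ler_wsqrtr.
    by apply: (le_trans un1); rewrite ler_nat (leq_trans mu).
  have -> : K / N%:R = K / Num.sqrt N%:R / Num.sqrt N%:R by rewrite -mulrA -invfM sNE.
  apply: ler_wpM2r; first by rewrite invr_ge0 ltW.
  rewrite ler_pdivrMr// mulrC -ler_pdivrMr ?divr_gt0//.
  by apply: le_trans us; rewrite /u invf_div mulrC mulrAC.
have hboth : c / 2 / Num.sqrt N%:R <= Pr (deep (eps * Num.sqrt M%:R) M `&` small B M).
  have cover : Pr (deep (eps * Num.sqrt M%:R) M) <=
     Pr (deep (eps * Num.sqrt M%:R) M `&` small B M) + Pr (~` small B M).
    have mI : measurable (deep (eps * Num.sqrt M%:R) M `&` small B M).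
      exact: measurableI.
    rewrite -lee_fin EFinD !PrE//; last exact: measurableC.
    apply: (le_trans _ (measureU2 _ mI (measurableC ms))).
    apply: le_measure; rewrite ?inE//.
      by apply: measurableU => //; exact: measurableC.
    by move=> y hy; case: (pselect (small B M y)) => hs; [left|right].
  have cM : c / Num.sqrt N%:R <= c / Num.sqrt M%:R.
    rewrite ler_pM2l// lef_pV2 ?posrE//; last by rewrite sqrtr_gt0 ltr0n.
    by apply: ler_wsqrtr; rewrite ler_nat.
  have -> : c / 2 / Num.sqrt N%:R = c / Num.sqrt N%:R - c / 2 / Num.sqrt N%:R.
    by field; rewrite gt_eqF.
  lra.
apply: (@le_trans _ _ (Pr (good kappa m) * Pr (deep (eps * Num.sqrt M%:R) M `&` small B M))).
  by rewrite mulrC; apply: ler_wpM2l => //; exact: Pr_ge0.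
have mg := measurable_good kappa.
have mI : measurable (deep (eps * Num.sqrt M%:R) M `&` small B M) by exact: measurableI.
rewrite -(Pr_drop_first_indep nu iid m)//; last exact: good_depends.
apply: le_Pr => //.
  apply: measurableI => //.
  by rewrite -[X in measurable X]setTI; exact: measurable_drop_first.
by rewrite [in X in _ `<=` X]NE; apply: good_extend => //; rewrite /M; clear -mN4; lia.
Qed.

Lemma ar2_surv_lower (p : nat) : (3 < p)%N ->
  exists2 c : R, 0 < c & exists n0, forall N, (n0 <= N)%N ->
    c / (Num.sqrt N%:R * N%:R `^ (2 / p%:R)) <= Pr (ar2_stay N).
Proof.
move=> p3; have [eps [cd [eps0 cd0 D]]] := deep_ge.
have [k wk] := Pr_window_gt0 nu i1 EY0 nondeg.
set w := Pr _ in wk.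
have r1 : 0 < 1 - `|rho| by rewrite subr_gt0.
have [kappa [ka0 ka1 ka2]] : exists kappa : R,
    [/\ 0 < kappa, 4 * kappa <= eps & 2 * kappa <= k.+1%:R^-1].
  exists (Num.min (eps / 4) (k.+1%:R^-1 / 2)); split.
  - by rewrite lt_min !divr_gt0// invr_gt0.
  - by rewrite mulrC -ler_pdivlMr// ge_min lexx.
  - by rewrite mulrC -ler_pdivlMr// ge_min lexx orbT.
have [|c [n1 [c0 ext]]] := Pr_good_extend p kappa ka0 (ltnW (ltnW p3)).
  by exists eps, cd; split.
have mw := measurable_coord_preimage 0 _ (@measurable_window R k).
have w0 : 0 <= w by exact: Pr_ge0.
have w1 : w <= 1 by exact: Pr_le1.
pose v := k.+1%:R / (1 - `|rho|) / kappa.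
have v0 : 0 <= v by rewrite !divr_ge0// ltW.
pose n2 := (Num.truncn (v ^+ 2)).+1.
have base N : (n2 <= N)%N -> w ^+ N <= Pr (good kappa N).
  move=> nN; rewrite -(Pr_box nu iid _ N (measurable_window k)).
  apply: le_Pr; [|exact: measurable_good|].
    by apply: (@measurable_box R _ (fun=> window k)) => i; exact: measurable_window.
  move=> y hy.
  have yi i : (i < N)%N -> - k.+1%:R <= y i <= - k.+1%:R^-1.
    by move=> iN; apply: hy; rewrite mem_iota.
  have NR1 : 1 <= N%:R :> R by rewrite ler1n; apply: leq_trans nN.
  have sN1 : Num.sqrt N%:R <= N%:R :> R.
    rewrite -[leRHS]ger0_norm// -sqrtr_sqr; apply: ler_wsqrtr.
    by rewrite expr2 ler_peMr.
  have ik : 0 < k.+1%:R^-1 :> R by rewrite invr_gt0.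
  split; first split.
  - apply: ar2_stay_nonpos_innovations => // i /yi /andP[_ h].
    by apply: (le_trans h); rewrite oppr_le0 ltW.
  - rewrite /=; apply: (@le_trans _ _ (\sum_(i < N) (- k.+1%:R^-1))).
      by apply: ler_sum => i _; case/andP: (yi i (ltn_ord i)).
    rewrite sumr_const card_ord mulNrn lerN2 -[leRHS]mulr_natr.
    by apply: ler_pM => //; rewrite mulr_ge0// ltW.
  - rewrite /=; have h : `|incr rho (0 + N) y| <= `|incr rho 0 y| + k.+1%:R / (1 - `|rho|).
      apply: incr_bound => // i iN; rewrite add0n.
      have /andP[h1 h2] := yi i iN; rewrite ler_norml h1 /=.
      by apply: (le_trans h2); apply: (@le_trans _ _ 0); rewrite ?oppr_le0 ?ltW.
    rewrite incr0 normr0 !add0r in h; apply: (le_trans h).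
    rewrite [leRHS]mulrC -ler_pdivrMr// -/v -(ger0_norm v0) -sqrtr_sqr.
    apply: ler_wsqrtr; apply: (le_trans (ltW (truncnS_gt _))); rewrite ler_nat.
    exact: nN.
pose n3 := (Num.truncn c^-1).+1.
pose n0 := maxn 2 (maxn n1 (maxn n2 n3)).
have n0E m : (n0 <= m)%N -> [/\ (2 <= m)%N, (n1 <= m)%N, (n2 <= m)%N & (n3 <= m)%N].
  by rewrite /n0 !geq_max => /and4P[].
pose f N : R := Num.sqrt N%:R * N%:R `^ (2 / p%:R).
have f1 N : (0 < N)%N -> 1 <= f N.
  move=> N0; have NR1 : 1 <= N%:R :> R by rewrite ler1n.
  rewrite -[leLHS]mulr1 /f; apply: ler_pM => //.
    by rewrite -[leLHS]sqrtr1; apply: ler_wsqrtr.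
  by rewrite -[leLHS](@powRr0 R N%:R); apply: ler_powR.
pose c1 := w ^+ (n0 ^ p).
have c10 : 0 < c1 by exact: exprn_gt0.
exists c1 => //; exists n0 => N nN; rewrite -/(f N).
apply: (@le_trans _ _ (Pr (good kappa N))); last first.
  apply: le_Pr; [exact: measurable_good|exact: measurable_ar2_stay|].
  by move=> y [[]].
elim/ltn_ind: N nN => N IH nN.
have [N2 _ Nn2 _] := n0E N nN.
have N0 : (0 < N)%N by exact: ltnW.
have fN := f1 N N0.
have fN0 : 0 < f N by exact: lt_le_trans fN.
have [Nlt|Nge] := ltnP N (n0 ^ p).
  apply: le_trans (base N Nn2); apply: (@le_trans _ _ c1).
    by rewrite ler_pdivrMr// ler_peMr// ltW.
  by rewrite /c1; apply: ler_wiXn2l => //; exact: ltnW.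
have [m /andP[mN Nm]] := exists_nat_root p N (ltn_trans (isT : 0 < 3)%N p3).
have n0m : (n0 <= m)%N.
  rewrite -ltnS -(@ltn_exp2r _ _ p); first exact: leq_ltn_trans Nm.
  exact: ltn_trans p3.
have [m2 mn1 mn2 mn3] := n0E m n0m.
have mltN : (m < N)%N.
  apply: leq_trans mN; rewrite -[X in (X < _)%N]expn1 ltn_exp2l//.
  exact: ltn_trans p3.
have IHm := IH m mltN n0m.
apply: le_trans (ext m N mn1 _); last by rewrite mN.
have m0 : 0 < m%:R :> R by rewrite ltr0n; exact: ltnW.
have mR1 : 1 <= m%:R :> R by rewrite ler1n; exact: ltnW.
have sN : 0 < Num.sqrt N%:R :> R by rewrite sqrtr_gt0 ltr0n.
have sm : 0 < Num.sqrt m%:R :> R by rewrite sqrtr_gt0.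
have p0 : p%:R != 0 :> R by rewrite pnatr_eq0 -lt0n; exact: ltn_trans p3.
have pN : m%:R ^+ 2 <= N%:R `^ (2 / p%:R) :> R.
  have -> : m%:R ^+ 2 = (m ^ p)%:R `^ (2 / p%:R) :> R.
    rewrite natrX -[m%:R ^+ p]powR_mulrn ?ltW// -powRrM mulrCA mulfV// mulr1.
    by rewrite powR_mulrn// ltW.
  by apply: ge0_ler_powR; rewrite ?nnegrE ?divr_ge0// ler_nat.
have fm : f m <= m%:R.
  have -> : m%:R = Num.sqrt m%:R * Num.sqrt m%:R :> R by rewrite -expr2 sqr_sqrtr// ltW.
  rewrite /f ler_pM2l// -powR12_sqrt; last exact: ltW.
  apply: ler_powR => //; rewrite ler_pdivrMr; last by rewrite ltr0n; exact: ltn_trans p3.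
  by rewrite ler_pdivlMl// -natrM ler_nat.
have fm0 : 0 < f m by apply: lt_le_trans (f1 m (ltnW m2)).
have cm : c^-1 <= m%:R by apply: (le_trans (ltW (truncnS_gt _))); rewrite ler_nat.
have key : f m <= c * N%:R `^ (2 / p%:R).
  apply: (le_trans fm); apply: (@le_trans _ _ (c * m%:R ^+ 2)); last by rewrite ler_pM2l.
  rewrite expr2 mulrA; apply: ler_peMl; first exact: ltW.
  by rewrite -ler_pdivrMl// mulr1.
have P0 : 0 < N%:R `^ (2 / p%:R) :> R by rewrite powR_gt0// ltr0n.
apply: (@le_trans _ _ (c / Num.sqrt N%:R * (c1 / f m))); last first.
  by rewrite ler_pM2l// divr_gt0.
rewrite /f invfM mulrA.
have -> : c / Num.sqrt N%:R * (c1 / f m) = c1 / Num.sqrt N%:R * (c / f m).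
  by field; rewrite !gt_eqF.
rewrite ler_pM2l; last exact: divr_gt0.
by rewrite ler_pdivlMr// mulrC ler_pdivrMr.
Qed.

End polynomial_bounds.

Lemma cvg_ln_ratio {R : realType} (q : nat -> R) :
  (forall k, (3 < k)%N -> exists2 C : R, 0 < C & forall N, (0 < N)%N ->
     q N <= C * N%:R `^ k%:R^-1 / Num.sqrt N%:R) ->
  (forall k, (3 < k)%N -> exists2 c : R, 0 < c & exists n0, forall N, (n0 <= N)%N ->
     c / (Num.sqrt N%:R * N%:R `^ (2 / k%:R)) <= q N) ->
  (fun N : nat => ln (q N) / ln N%:R) @ \oo --> (- (2 : R)^-1).
Proof.
move=> up lo; apply/cvgrPdist_le => e e0.
have [k [k3 ke]] : exists k : nat, (3 < k)%N /\ 2 / k%:R <= e / 2.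
  exists (Num.truncn (4 / e)).+4; split => //.
  rewrite ler_pdivrMr//.
  have : 4 / e <= (Num.truncn (4 / e)).+4%:R.
    apply: (le_trans (ltW (truncnS_gt _))); rewrite ler_nat.
    by do 3 apply: leqW.
  rewrite ler_pdivrMr// => h; lra.
have k0 : 0 < k%:R^-1 :> R by rewrite invr_gt0 ltr0n; apply: ltn_trans k3.
have [C C0 HC] := up k k3; have [c c0 [n0 Hc]] := lo k k3.
pose A := Num.max (`|ln C| * 2 / e) (`|ln c| * 2 / e).
exists (maxn n0 (maxn 2 (Num.truncn (expR A)).+1)) => // N /=.
rewrite !geq_max => /and3P[nN N2 NA].
have N0 : (0 < N)%N by exact: ltnW.
have NR0 : 0 < N%:R :> R by rewrite ltr0n.
have AN : A <= ln N%:R.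
  rewrite -ler_expR lnK ?posrE//; apply: (le_trans (ltW (truncnS_gt _))).
  by rewrite ler_nat.
have l0 : 0 < ln N%:R :> R by rewrite ln_gt0// ltr1n.
have sN : 0 < Num.sqrt N%:R :> R by rewrite sqrtr_gt0.
have lsN : ln (Num.sqrt N%:R) = 2^-1 * ln N%:R :> R.
  by rewrite -powR12_sqrt ?ltW// ln_powR.
have hc := Hc N nN; have hC := HC N N0.
have pw z : 0 < N%:R `^ z :> R by exact: powR_gt0.
have lb0 : 0 < c / (Num.sqrt N%:R * N%:R `^ (2 / k%:R)).
  by rewrite divr_gt0// mulr_gt0.
have q0 : 0 < q N by exact: lt_le_trans hc.
have ub : ln (q N) <= ln C + k%:R^-1 * ln N%:R - 2^-1 * ln N%:R.
  rewrite -lsN -ln_powR -lnM ?posrE// -ln_div ?posrE//; last by rewrite mulr_gt0.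
  by rewrite ler_ln ?posrE// divr_gt0// mulr_gt0.
have lb : ln c - (2^-1 * ln N%:R + 2 / k%:R * ln N%:R) <= ln (q N).
  rewrite -lsN -ln_powR -lnM ?posrE// -ln_div ?posrE//; last by rewrite mulr_gt0.
  by rewrite ler_ln ?posrE.
have hAC : `|ln C| <= e / 2 * ln N%:R.
  have : `|ln C| * 2 / e <= ln N%:R by apply: le_trans AN; rewrite le_max lexx.
  rewrite ler_pdivrMr// => h; lra.
have hAc : `|ln c| <= e / 2 * ln N%:R.
  have : `|ln c| * 2 / e <= ln N%:R by apply: le_trans AN; rewrite le_max lexx orbT.
  rewrite ler_pdivrMr// => h; lra.
have h1 := ler_norm (ln C); have h2 := ler_norm (- ln c); rewrite normrN in h2.
have kl : 2 / k%:R * ln N%:R <= e / 2 * ln N%:R by rewrite ler_pM2r.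
have kl' : k%:R^-1 * ln N%:R <= 2 / k%:R * ln N%:R :> R.
  by apply: ler_wpM2r; [exact: ltW|rewrite ler_peMl ?ler1n// ltW].
have -> : - 2^-1 - ln (q N) / ln N%:R = - (2^-1 * ln N%:R + ln (q N)) / ln N%:R.
  by field; rewrite gt_eqF.
rewrite normrM normfV (gtr0_norm l0) ler_pdivrMr// normrN ler_norml.
apply/andP; split; lra.
Qed.

Theorem theorem1p1 (d : measure_display) (T : measurableType d) (R : realType)
  (P : probability T R) (Y : nat -> {RV P >-> R}) (a1 a2 : R) (alpha : R) :
  iid_seq Y -> nondegenerate_rv (Y 0%N) ->
  a1 + a2 = 1 -> -1 < a2 -> a2 <= 1 ->
  ('E_P[Y 0%N] = 0)%E ->
  0 < alpha ->
  (\int[P]_w (expR (`|Y 0%N w| `^ alpha))%:E < +oo)%E ->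
  (`|a2| < 1 ->
     (fun N : nat => ln (survival_prob Y a1 a2 N) / ln N%:R) @ \oo --> (- (2 : R)^-1))
  /\
  (a2 = 1 ->
     exists c C : R, 0 < c /\ 0 < C /\
       \forall N \near \oo,
         c / N%:R <= survival_prob Y a1 a2 N <= C / N%:R).
Proof.
move=> iidY nondegY a12 a2N1 a21 EY alpha0 expY.
pose nu := path_law Y.
have iid : iid_law nu by exact: path_law_iid.
have sE b1 b2 N : survival_prob Y b1 b2 N = Pr nu (ar2_stay b1 b2 N) by [].
have mabs : measurable_fun setT (fun y : @seqR R => `|y 0%N|).
  by apply: measurableT_comp => //; exact: measurable_coord.
have expm : (\int[nu]_y (expR (`|y 0%N| `^ alpha))%:E < +oo)%E.
  rewrite /nu /path_law ge0_integral_distribution//.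
    apply/measurable_EFinP; apply: measurableT_comp => //.
    exact: (@measurableT_comp _ _ _ _ _ _ (fun x : R => x `^ alpha)).
have i1 := integ_coord nu alpha alpha0 expm.
have EY0 : Rintegral nu setT (fun y : @seqR R => y 0%N) = 0.
  rewrite /Rintegral /nu /path_law integral_distribution.
  - by move: EY; rewrite unlock => EY; rewrite [X in fine X]EY.
  - by apply/measurable_EFinP; exact: measurable_coord.
  apply/integrableP; split.
    by apply/measurable_EFinP; exact: (measurable_funPT (Y 0%N)).
  move/integrableP : i1 => [_].
  rewrite {1}/nu /path_law ge0_integral_distribution//.
  exact/measurable_EFinP.
have nondeg : nu [set y : @seqR R | y 0%N = 0] <> 1%E by exact: nondegY.
split=> [a2lt|a2E].
  have a1E : a1 = 1 + - a2 by lra.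
  have rho1 : `|- a2| < 1 by rewrite normrN.
  apply: cvg_ln_ratio => k k3.
    have k0 : (0 < k)%N by exact: ltn_trans k3.
    have [C C0 HC] := ar2_surv_upper nu iid alpha alpha0 expm EY0 nondeg (- a2) rho1 k k0.
    by exists C => // N N0; rewrite sE a1E -[X in ar2_stay _ X]opprK; exact: HC.
  have [c c0 [n0 Hc]] := ar2_surv_lower nu iid alpha alpha0 expm EY0 nondeg (- a2) rho1 k k3.
  by exists c => //; exists n0 => N nN; rewrite sE a1E -[X in ar2_stay _ X]opprK; exact: Hc.
have i2 := integ_coord_sqr nu alpha alpha0 expm.
have neg := negative_part_lt0 nu i1 EY0 nondeg.
have [c [C [c0 [C0 H]]]] :=
  alternating_survival nu iid (walk_surv_bounds nu iid i1 i2 EY0 neg).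
exists c, C; split => //; split => //.
exists 2%N => // N /= N2; rewrite sE a2E.
have -> : a1 = 0 by lra.
exact: H.
Qed.
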